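(* Let $\Omega$ be a nonempty open subset of $\mathbb{R}^N$ of finite measure, $\omega$ an admissible weight function in $\Omega$, and $1<q<+\infty$. Let $F:L^q(\Omega)\to[-\infty,+\infty]$ be proper, bounded from below, convex, lower semicontinuous with respect to the $L^q(\Omega)$ norm, and such that $F(u)\to+\infty$ as $\|u\|_{L^q(\Omega)}\to+\infty$. Let $$I_\omega(u):=\mathrm{NLTV}_\omega(u)+F(u),\qquad u\in\mathrm{NLBV}_\omega(\Omega)\cap L^q(\Omega).$$ Then there exists $u_*\in\mathrm{NLBV}_\omega(\Omega)\cap L^q(\Omega)$ such that $$I_\omega(u_* )=m_*:=\inf_{u\in\mathrm{NLBV}_\omega(\Omega)\cap L^q(\Omega)}I_\omega(u).$$ Moreover, if $F$ is strictly convex then the minimizer is unique.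
   Context: An admissible weight function in $\Omega$ is a function $\omega:\Omega\times\Omega\to[0,+\infty)$ belonging to $\mathcal{C}^1(\Omega\times\Omega)$ with $\omega(x,y)=\omega(y,x)$ for all $(x,y)$. For $\phi\in\mathcal{C}^1_c(\Omega\times\Omega;\mathbb{R}^N)$, $$\mathrm{div}_\omega(\phi)(x):=\int_\Omega\mathrm{div}_x\left[\omega(x,y)(\phi(y,x)-\phi(x,y))\right]\mathrm{d}y,\quad x\in\Omega.$$ For $u\in L^1(\Omega)$, $$\mathrm{NLTV}_\omega(u):=\sup\left\{\int_\Omega u(x)\,\mathrm{div}_\omega(\phi)(x)\,\mathrm{d}x:\ \phi\in\mathcal{C}^1_c(\Omega\times\Omega;\mathbb{R}^N),\ \|\phi\|_\infty\le1\right\},$$ where $\|\phi\|_\infty$ is the supremum of the pointwise Euclidean norm, and $\mathrm{NLBV}_\omega(\Omega):=\{u\in L^1(\Omega):\mathrm{NLTV}_\omega(u)<+\infty\}$. *)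

(* Defs.v *)
From HB Require Import structures.
From mathcomp Require Import all_boot all_order all_algebra.
From mathcomp Require Import all_classical all_reals all_analysis.
From mathcomp Require Import measurable_realfun ess_sup_inf.
Import Order.TTheory GRing.Theory Num.Theory.
Import numFieldNormedType.Exports.

Set Implicit Arguments.
Unset Strict Implicit.
Unset Printing Implicit Defensive.

Local Open Scope classical_set_scope.
Local Open Scope ring_scope.

Definition borel_rV_display : measure_display.
Proof. exact: default_measure_display. Qed.

Section borel_rV.
Context (R : realType) (n : nat).

HB.instance Definition _ := @isMeasurable.Build borel_rV_display 'rV[R]_n
  <<s @open 'rV[R]_n >> (@sigma_algebra0 _ setT open) (@sigma_algebraC _ open)
  (@sigma_algebra_bigcup _ setT open).

Lemma open_measurable_rV (U : set 'rV[R]_n) : open U -> measurable U.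
Proof. by move=> oU; apply: sub_sigma_algebra. Qed.

End borel_rV.

Section cons_rV.
Context (R : realType).

Lemma measurable_coord (n : nat) (i : 'I_n) :
  measurable_fun setT (fun v : 'rV[R]_n => v 0 i : measurableTypeR R).
Proof.
apply: (measurability _ (RGenOInfty.measurableE R)) => _ [_ [a ->] <-].
rewrite setTI; apply: open_measurable_rV.
apply: open_comp; last exact: interval_open.
by move=> x _; exact: coord_continuous.
Qed.

Lemma measurable_rVP d (T : measurableType d) (n : nat) (f : T -> 'rV[R]_n) :
  (forall i, measurable_fun setT (fun x => f x 0 i : measurableTypeR R)) ->
  measurable_fun setT f.
Proof.
move=> mf; apply: (@measurability _ _ _ _ setT f (@open 'rV[R]_n)) => //.
move=> _ [U oU <-]; rewrite setTI.
pose B (p : 'rV[rat]_n * rat) := ball (map_mx ratr p.1 : 'rV[R]_n) (ratr p.2).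
have -> : U = \bigcup_p (if `[< B p `<=` U >] then B p else set0).
  apply/seteqP; split => [x Ux|x [p _]]; last by case: asboolP => // + ?; exact.
  have : nbhs x U by exact: open_nbhs_nbhs.
  rewrite -nbhs_ballE => -[e /= e0 xeU].
  have [r] : exists r : rat, ratr r \in `](0:R), e / 2[.
    by apply: rat_in_itvoo; rewrite divr_gt0.
  rewrite in_itv/= => /andP[r0 re].
  have xq i : exists q : rat, ratr q \in `](x 0 i - ratr r : R), (x 0 i + ratr r)[.
    by apply: rat_in_itvoo; rewrite ltrBlDr -addrA ltrDl addr_gt0.
  have {xq}[q xq] := choice xq.
  exists (\row_i q i, r) => //; case: asboolP.
    move=> _; split => //= i j; rewrite !mxE (ord1 i) /ball/=.
    move: (xq j); rewrite in_itv/= => /andP[q1 q2].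
    by rewrite ltr_distl q1 q2.
  case => y [_ Bpy]; apply: xeU; split => // i j.
  have := Bpy i j; rewrite !mxE (ord1 i) /ball/=.
  move: (xq j); rewrite in_itv/= => /andP[q1 q2] qy.
  rewrite (_ : x _ _ - _ = (x 0 j - ratr (q j)) + (ratr (q j) - y 0 j)); last first.
    by rewrite addrA subrK.
  rewrite (le_lt_trans (ler_normD _ _))// (splitr e) ltrD//; last exact: lt_trans re.
  apply: lt_trans re.
  by rewrite distrC ltr_distl q1 q2.
rewrite preimage_bigcup; apply: countable_bigcupT_measurable; first exact: countableP.
move=> p; case: asboolP => _; last by rewrite preimage_set0.
have [r0|r0] := ltP 0 (ratr p.2 : R); last first.
  rewrite (_ : _ @^-1` _ = set0)//; apply/seteqP; split=> // x [r0'].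
  by rewrite ltNge r0 in r0'.
rewrite (_ : _ @^-1` _ = \bigcap_(i in [set: 'I_n])
    ((fun x => f x 0 i) @^-1` (ball (ratr (p.1 0 i) : R) (ratr p.2)))); last first.
  apply/seteqP; split => [x [_ Bx] i _ /=|x /= Bx]; first by have := Bx 0 i; rewrite mxE.
  by split => // i j; rewrite mxE (ord1 i); exact: Bx.
apply: fin_bigcap_measurable => // i _.
rewrite -[X in measurable X]setTI; apply: mf => //.
exact: measurable_ball.
Qed.

Definition cons_rV (n : nat) (p : measurableTypeR R * 'rV[R]_n) : 'rV[R]_n.+1 :=
  row_mx (p.1)%:M p.2 : 'rV[R]_(1 + n).

Definition uncons_rV (n : nat) (v : 'rV[R]_n.+1) : measurableTypeR R * 'rV[R]_n :=
  (v 0 0, \row_i v 0 (lift 0 i)).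

Lemma cons_rV0 (n : nat) p : @cons_rV n p 0 0 = p.1.
Proof.
transitivity ((row_mx (p.1)%:M p.2 : 'rV[R]_(1 + n)) 0 (lshift n 0)).
  by congr (fun_of_matrix _ _ _); exact: val_inj.
by rewrite row_mxEl mxE.
Qed.

Lemma cons_rVS (n : nat) p i : @cons_rV n p 0 (lift 0 i) = p.2 0 i.
Proof.
transitivity ((row_mx (p.1)%:M p.2 : 'rV[R]_(1 + n)) 0 (rshift 1 i)).
  by congr (fun_of_matrix _ _ _); exact: val_inj.
by rewrite row_mxEr.
Qed.

Lemma cons_rVK (n : nat) : cancel (@cons_rV n) (@uncons_rV n).
Proof.
move=> [a v]; rewrite /uncons_rV cons_rV0; congr pair.
by apply/rowP => i; rewrite mxE cons_rVS.
Qed.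

Lemma measurable_cons_rV (n : nat) : measurable_fun setT (@cons_rV n).
Proof.
apply: measurable_rVP => i; case: (unliftP 0 i) => [j ->|->].
  under eq_fun do rewrite cons_rVS.
  exact: (measurableT_comp (measurable_coord j) measurable_snd).
by under eq_fun do rewrite cons_rV0; exact: measurable_fst.
Qed.

Lemma measurable_uncons_rV (n : nat) : measurable_fun setT (@uncons_rV n).
Proof.
apply: measurable_fun_pair; first exact: measurable_coord.
apply: measurable_rVP => i; under eq_fun do rewrite mxE.
exact: measurable_coord.
Qed.

Section lebesgue_step.
Local Open Scope ereal_scope.
Context (n : nat) (m : {sigma_finite_measure set 'rV[R]_n -> \bar R}).

Definition lebesgue_step : set 'rV[R]_n.+1 -> \bar R :=
  pushforward (@lebesgue_measure R \x m) (@cons_rV n).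

Let lebesgue_step0 : lebesgue_step set0 = 0.
Proof. by rewrite /lebesgue_step /pushforward preimage_set0 measure0. Qed.

Let lebesgue_step_ge0 A : 0 <= lebesgue_step A.
Proof. by rewrite /lebesgue_step /pushforward; exact: measure_ge0. Qed.

Let lebesgue_step_sigma_additive : semi_sigma_additive lebesgue_step.
Proof.
move=> F mF tF mUF; rewrite /lebesgue_step /pushforward preimage_bigcup.
have mcons X : measurable X -> measurable (@cons_rV n @^-1` X).
  by move=> mX; rewrite -[X in measurable X]setTI; exact: measurable_cons_rV.
apply: measure_semi_sigma_additive.
- by move=> k; exact: mcons.
- apply/trivIsetP => /= i j _ _ ij; rewrite -preimage_setI.
  by move/trivIsetP : tF => /(_ _ _ _ _ ij) ->//; rewrite preimage_set0.
- by rewrite -preimage_bigcup; exact: mcons.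
Qed.

HB.instance Definition _ := isMeasure.Build _ _ _ lebesgue_step
  lebesgue_step0 lebesgue_step_ge0 lebesgue_step_sigma_additive.

Let lebesgue_step_sigma_finite : sigma_finite setT lebesgue_step.
Proof.
have /sigma_finiteP[F [TF ndF Foo]] := sigma_finiteT (@lebesgue_measure R).
have /sigma_finiteP[G [TG ndG Goo]] := sigma_finiteT m.
exists (fun k => @uncons_rV n @^-1` (F k `*` G k)).
  rewrite -preimage_bigcup -[LHS](preimage_setT (@uncons_rV n)); congr preimage.
  rewrite -setXTT TF TG predeqE => -[x y]; split.
    move=> [/= [i _ Fix] [k _ Gky]]; exists (maxn i k) => //; split.
    - by move: x Fix; exact/subsetPset/ndF/leq_maxl.
    - by move: y Gky; exact/subsetPset/ndG/leq_maxr.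
  by move=> [k _ []/= ? ?]; split; exists k.
move=> k; have [? ?] := Foo k; have [? ?] := Goo k; split.
  rewrite -[X in measurable X]setTI; apply: measurable_uncons_rV => //.
  exact: measurableX.
rewrite /lebesgue_step /pushforward -comp_preimage.
rewrite (_ : _ \o _ = id) ?preimage_id; last by apply/funext => p; exact: cons_rVK.
by rewrite product_measure1E// lte_mul_pinfty// ge0_fin_numE.
Qed.

HB.instance Definition _ := Measure_isSigmaFinite.Build _ _ _ lebesgue_step
  lebesgue_step_sigma_finite.

End lebesgue_step.

Fixpoint lebesgue_rV (n : nat) : {sigma_finite_measure set 'rV[R]_n -> \bar R} :=
  if n is k.+1 then @lebesgue_step k (lebesgue_rV k) else \d_(0 : 'rV[R]_0).

Lemma lebesgue_rV_box (n : nat) (A : 'I_n -> set (measurableTypeR R)) :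
  (forall i, measurable (A i)) ->
  (lebesgue_rV n [set v | forall i, A i (v 0%R i)]
   = \prod_(i < n) lebesgue_measure (A i))%E.
Proof.
elim: n A => [|n IH] A mA.
  by rewrite big_ord0 /= diracE mem_set// => -[].
rewrite big_ord_recl.
have consE : @cons_rV n @^-1` [set v | forall i, A i (v 0 i)] =
    A ord0 `*` [set v : 'rV[R]_n | forall i, A (lift ord0 i) (v 0 i)].
  apply/seteqP; split => [p /= h|p /= [h0 h] i].
    split => [|i] /=; first by rewrite -(cons_rV0 p); exact: h.
    by rewrite -cons_rVS; exact: h.
  case: (unliftP ord0 i) => [j ->|->]; first by rewrite cons_rVS; exact: h.
  by rewrite cons_rV0.
transitivity ((lebesgue_measure \x lebesgue_rV n)%E
  (A ord0 `*` [set v : 'rV[R]_n | forall i, A (lift ord0 i) (v 0 i)])).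
  by rewrite -consE.
rewrite product_measure1E//; first by congr (_ * _)%E; exact: IH.
rewrite (_ : [set _ | _] = \bigcap_(i in [set: 'I_n])
   ((fun v : 'rV[R]_n => v 0 i : measurableTypeR R) @^-1` A (lift ord0 i))).
  apply: fin_bigcap_measurable => // i _.
  by rewrite -[X in measurable X]setTI; exact: measurable_coord.
by apply/seteqP; split => [v /= h i _|v /= h i]; exact: h.
Qed.

End cons_rV.

Section calculus.
Context (R : realType).

(* Meant for finite-dimensional [V] and open [U]: the continuity of [x |-> 'd f x v]
   for each vector [v] is then the continuity of the differential itself. Only the
   values of [f] on [U] matter. *)
Definition C1_on (V W : normedModType R) (U : set V) (f : V -> W) : Prop :=
  (forall x, U x -> differentiable f x) /\
  (forall v x, U x -> {for x, continuous (fun y => 'd f y v)}).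

(* [`|v|] on row vectors is the sup norm, hence this definition. *)
Definition euclidean_norm (n : nat) (v : 'rV[R]_n) : R :=
  Num.sqrt (\sum_(i < n) v 0 i ^+ 2).

Definition divergence (n : nat) (f : 'rV[R]_n -> 'rV[R]_n) (x : 'rV[R]_n) : R :=
  \sum_(i < n) 'D_(delta_mx 0 i) (fun z => f z 0 i) x.

End calculus.

(* Functions on [Omega] or [Omega `*` Omega] are represented by total functions
   whose values elsewhere are irrelevant. *)
Section nonlocal_total_variation.
Context (R : realType) (N : nat) (Omega : set 'rV[R]_N).

Record admissible_weight (w : 'rV[R]_N * 'rV[R]_N -> R) : Prop := {
  weight_ge0 : forall x y, Omega x -> Omega y -> 0 <= w (x, y) ;
  weight_C1 : C1_on (Omega `*` Omega) w ;
  weight_sym : forall x y, Omega x -> Omega y -> w (x, y) = w (y, x) }.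

(* Elements of C^1_c(Omega x Omega; R^N), extended by zero outside Omega x Omega. *)
Definition C1c_field (phi : 'rV[R]_N * 'rV[R]_N -> 'rV[R]_N) : Prop :=
  [/\ C1_on (Omega `*` Omega) phi,
      compact (closure [set p | phi p != 0]) &
      closure [set p | phi p != 0] `<=` Omega `*` Omega].

Definition sup_norm (phi : 'rV[R]_N * 'rV[R]_N -> 'rV[R]_N) : \bar R :=
  ereal_sup [set (euclidean_norm (phi p))%:E | p in Omega `*` Omega].

Definition div_weight (w : 'rV[R]_N * 'rV[R]_N -> R)
    (phi : 'rV[R]_N * 'rV[R]_N -> 'rV[R]_N) (x : 'rV[R]_N) : R :=
  \int[lebesgue_rV R N]_(y in Omega)
    divergence (fun z => w (z, y) *: (phi (y, z) - phi (z, y))) x.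

Definition NLTV (w : 'rV[R]_N * 'rV[R]_N -> R) (u : 'rV[R]_N -> R) : \bar R :=
  ereal_sup [set (\int[lebesgue_rV R N]_(x in Omega) (u x * div_weight w phi x))%:E
            | phi in [set phi | C1c_field phi /\ (sup_norm phi <= 1)%E]].

Definition NLBV (w : 'rV[R]_N * 'rV[R]_N -> R) : set ('rV[R]_N -> R) :=
  [set u | (lebesgue_rV R N).-integrable Omega (EFin \o u) /\ (NLTV w u < +oo)%E].

Hypothesis oOmega : open Omega.

Definition lebesgue_on : {measure set 'rV[R]_N -> \bar R} :=
  mrestr (lebesgue_rV R N) (open_measurable_rV oOmega).

Lemma exponent_ge1 (q : R) : 1 < q -> (1 <= q%:E)%E.
Proof. by move=> q1; rewrite lee_fin ltW. Qed.

(* Classes of Borel functions on R^N modulo equality a.e. on [Omega]. *)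
Definition Lq (q : R) (q1 : 1 < q) : Type :=
  LspaceType lebesgue_on (exponent_ge1 q1).

End nonlocal_total_variation.

(* [LspaceType] is a type of classes modulo a.e. equality without a vector space
   structure, so linear combinations are determined here by representatives:
   [w] is the class of [t u + (1 - t) v] iff it is a.e. equal to it. *)
Section Lspace_functionals.
Context d (T : measurableType d) (R : realType) (mu : {measure set T -> \bar R}).
Context (p : \bar R) (p1 : (1 <= p)%E).
Local Notation L := (LspaceType mu p1).

Lemma Lspace_eqP (u v : L) : u = v <-> (u : T -> R) = v %[ae mu].
Proof.
split=> [->|uv]; first exact: ae_eq_refl.
have : LebesgueSpace.sort u = LebesgueSpace.sort v.
  rewrite -[LHS]reprK -[RHS]reprK; apply/eqmodP; exact/asboolP.
case: u v {uv} => [u [[cu]]] [v [[cv]]] /= uv; subst v.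
by rewrite (Prop_irrelevance cu cv).
Qed.

Lemma Lspace_repr (f : T -> R) : f \in Lfun mu p ->
  exists w : L, (w : T -> R) = f %[ae mu].
Proof.
move=> fL.
have mf : measurable_fun setT (f : T -> measurableTypeR R).
  by move: fL; rewrite inE => /andP[]; rewrite inE.
pose g : {mfun T >-> measurableTypeR R} :=
  HB.pack (f : T -> measurableTypeR R) (isMeasurableFun.Build _ _ T (measurableTypeR R) f mf).
pose W : {mfun_ mu, T >-> measurableTypeR R} := (\pi g)%qT.
have Wf : (W : T -> R) = f %[ae mu].
  have /eqmodP/asboolP : (repr W = g %[mod {mfun_ mu, T >-> measurableTypeR R}])%qT.
    by rewrite reprK.
  by [].
have Wfin : finite_norm mu p W.
  have mW : measurable_fun setT (W : T -> measurableTypeR R) by exact: measurable_funPT.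
  suff NE : 'N[mu]_p[EFin \o (W : T -> R)]%E = 'N[mu]_p[EFin \o f]%E.
    rewrite /finite_norm [ltLHS]NE.
    by move: fL; rewrite inE => /andP[_]; rewrite inE.
  rewrite unlock; case: p p1 => [r r1|_|//].
    congr (_ `^ _)%E; apply: ae_eq_integral => //.
    + apply: (measurableT_comp (measurable_poweR _)); apply: measurableT_comp => //.
      exact/measurable_EFinP.
    + apply: (measurableT_comp (measurable_poweR _)); apply: measurableT_comp => //.
      exact/measurable_EFinP.
    + by apply: filterS Wf => x /(_ I) /= ->.
  case: ifPn => // _; apply: eq_ess_sup.
  by apply: filterS Wf => x /(_ I) /= ->.
exists (LebesgueSpace.Pack (LebesgueSpace.Class (isFinLebesgue.Build _ _ _ _ _ p1 W Wfin))).
exact: Wf.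
Qed.

Definition Lspace_dist (u v : L) : \bar R := 'N[mu]_p[EFin \o (fun x => u x - v x)].

Definition is_convex_comb (t : R) (u v w : L) : Prop :=
  (w : T -> R) = (fun x => t * u x + (1 - t) * v x) %[ae mu].

Context (F : L -> \bar R).
Local Open Scope ereal_scope.

Definition proper_functional : Prop :=
  (forall u, -oo < F u) /\ (exists u, F u < +oo).

Definition bounded_below : Prop := exists c : R, forall u, c%:E <= F u.

Definition convex_functional : Prop := forall (t : R) (u v w : L),
  (0 <= t <= 1)%R -> is_convex_comb t u v w ->
  F w <= t%:E * F u + (1 - t)%:E * F v.

(* Strict inequality for all pairs of distinct points. For a proper [F] this forces
   [F] to be finite; the variant below only constrains the effective domain. *)
Definition strictly_convex_functional : Prop := forall (t : R) (u v w : L),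
  (0 < t < 1)%R -> u <> v -> is_convex_comb t u v w ->
  F w < t%:E * F u + (1 - t)%:E * F v.

Definition strictly_convex_on_domain : Prop := forall (t : R) (u v w : L),
  (0 < t < 1)%R -> u <> v -> F u < +oo -> F v < +oo -> is_convex_comb t u v w ->
  F w < t%:E * F u + (1 - t)%:E * F v.

Definition lsc_functional : Prop := forall (u : L) (a : R), a%:E < F u ->
  exists2 e : R, (0 < e)%R &
    forall v, Lspace_dist v u < e%:E -> a%:E < F v.

Definition coercive_functional : Prop := forall M : R, exists r : R,
  forall u : L, r%:E < 'N[mu]_p[EFin \o (u : T -> R)] -> M%:E < F u.

End Lspace_functionals.

Definition minimizer (T : Type) (R : realType) (D : set T) (I : T -> \bar R) : set T :=
  [set u | D u /\ I u = ereal_inf [set I v | v in D]].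

(* Main.v *)
Require Import Defs.
From mathcomp Require Import all_boot all_order all_algebra.
From mathcomp Require Import all_classical all_reals all_analysis.
From mathcomp Require Import measurable_realfun lra.
Import Order.TTheory GRing.Theory Num.Theory.
Import numFieldNormedType.Exports.

(** The nonlocal total variation is a supremum of the linear functionals
    [u |-> \int u div_w(phi)], where [phi] ranges over the C^1 fields with compact
    support and norm at most 1. For such a field the integrand that defines
    [div_w(phi)] is continuous on [Omega `*` Omega] with compact support, hence
    bounded, so [div_w(phi)] is measurable and bounded on [Omega]
    ([div_weight_measurable], [div_weight_bounded]). As [Omega] has finite measure,
    each of these functionals is continuous on L^q, and their supremum is convex and
    lower semicontinuous ([NLTV_convex], [NLTV_lsc]). It is also nonnegative, so its
    sum with [F] inherits from [F] coercivity and boundedness from below.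

    A convex, lower semicontinuous, coercive functional on L^q that is bounded below
    attains its infimum ([exists_minimizer]): its sublevel sets above the infimum form
    a decreasing sequence of nonempty bounded closed convex sets, and such a sequence
    has a common point ([nested_closed_convex]). This last fact replaces weak
    compactness. It follows from completeness ([Lq_complete]) and uniform convexity
    ([Lq_uniform_convexity]), since elements of almost minimal norm in these sets form
    a Cauchy sequence. Uniform convexity is obtained for all q > 1 by integrating one
    pointwise inequality ([uniform_convexity_powR]).

    If [F] is strictly convex, then the sum would fall below its infimum at the
    midpoint of two distinct minimizers ([minimizer_unique]). *)

Set Implicit Arguments.
Unset Strict Implicit.
Unset Printing Implicit Defensive.

Local Open Scope classical_set_scope.
Local Open Scope ring_scope.

(** * A modulus of uniform convexity for powers *)

Section uniform_convexity.
Context {R : realType}.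
Implicit Types (q t a b : R).

Lemma continuous_norm_powR q : 0 < q -> continuous (fun t : R => `|t| `^ q).
Proof.
move=> q0 t; have [->|t0] := eqVneq t 0.
  rewrite /continuous_at normr0 powR0 ?gt_eqF//; apply/cvgr0Pnorm_lt => e e0.
  near=> s; rewrite ger0_norm ?powR_ge0//.
  rewrite -[ltRHS]powRr1 ?(ltW e0)// -(mulVf (negbT (gt_eqF q0))) powRrM.
  apply: gt0_ltr_powR; rewrite ?nnegrE ?powR_ge0//.
  near: s; apply: (@cvgr0_norm_lt _ _ _ _ _ id _); first exact: cvg_id.
  exact: powR_gt0.
apply: (@continuous_comp R R R Num.norm (fun x => x `^ q)); first exact: norm_continuous.
apply: differentiable_continuous; apply/derivable1_diffP.
by apply: derivable_powR; rewrite in_itv/= andbT normr_gt0.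
Unshelve. all: by end_near. Qed.

(** Written as [t * expR ((q - 1) * ln t)], the power is bounded below by
    [1 + s <= expR s] at [s = (q - 1) * ln t] and at [s = - ln t]; strictness comes
    from the first use. *)
Lemma powR_gt_tangent1 q t : 1 < q -> 0 <= t -> t != 1 -> 1 + q * (t - 1) < t `^ q.
Proof.
move=> q1 t0 t1; have q0 : 0 < q by exact: lt_trans q1.
have [->|tn0] := eqVneq t 0; first by rewrite powR0 ?gt_eqF//; lra.
have {tn0}t0 : 0 < t by rewrite lt_neqAle eq_sym tn0.
have lnt : (q - 1) * ln t != 0 by rewrite mulf_neq0 ?ln_eq0// subr_eq0 gt_eqF.
have -> : t `^ q = t * expR ((q - 1) * ln t).
  by rewrite -(mulr_powRB1 (ltW t0) q0) /powR gt_eqF.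
have := expR_gt1Dx lnt; have := expR_ge1Dx (- ln t).
rewrite expRN lnK ?posrE// -(ler_pM2l t0) -(ltr_pM2l t0) mulfV ?gt_eqF//.
move=> h1 h2; have := ler_wpM2l (ltW (_ : 0 < q - 1)) h1; rewrite subr_gt0.
move=> /(_ q1) h3; lra.
Qed.

(** For [c = (1 + |t|) / 2], the numbers [1 / c] and [|t| / c] have mean [1], so adding
    the tangent inequalities at these two points cancels the linear terms. *)
Lemma powR_midpoint_lt q t : 1 < q -> -1 <= t < 1 ->
  `|(1 + t) / 2| `^ q < (1 + `|t| `^ q) / 2.
Proof.
move=> q1 /andP[tN1 t1]; have q0 : 0 < q by exact: lt_trans q1.
have [t1'|t1'] := eqVneq `|t| 1.
  have -> : t = -1.
    by move: t1'; case: (ler0P t) => // _ h; lra.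
  by rewrite subrr mul0r normr0 powR0 ?gt_eqF// normrN normr1 powR1; lra.
set c := (1 + `|t|) / 2; have c0 : 0 < c by rewrite divr_gt0// ltr_pwDl.
apply: (@le_lt_trans _ _ (c `^ q)).
  apply: ge0_ler_powR; rewrite ?nnegrE ?(ltW q0) ?(ltW c0)//.
  rewrite normrM [`|2^-1|]ger0_norm ?invr_ge0// ler_pM2r ?invr_gt0//.
  by rewrite (le_trans (ler_normD _ _))// normr1.
have cn0 : c != 0 by rewrite gt_eqF.
have h1 : c^-1 != 1.
  by rewrite invr_eq1; apply: contra t1' => /eqP c1; apply/eqP; move: c1; rewrite /c; lra.
have h2 : `|t| / c != 1.
  apply: contra t1' => /eqP /(congr1 (fun x => x * c)).
  by rewrite divfK// mul1r => c1; apply/eqP; move: c1; rewrite /c; lra.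
have := ltrD (powR_gt_tangent1 q1 _ h1) (powR_gt_tangent1 q1 _ h2).
have c_ge0 : 0 <= c^-1 by rewrite invr_ge0 ltW.
rewrite c_ge0 divr_ge0 ?(ltW c0)// => /(_ isT isT).
have cV : c^-1 `^ q * c `^ q = 1 by rewrite -powRM ?(ltW c0)// mulVf// powR1.
have tV : (`|t| / c) `^ q * c `^ q = `|t| `^ q.
  by rewrite -powRM ?(ltW c0)// ?divfK// divr_ge0 ?(ltW c0).
rewrite -(ltr_pM2r (powR_gt0 q c0)) [X in _ < X]mulrDl cV tV => h.
rewrite ltr_pdivlMr// (le_lt_trans _ h)// mulrC ler_pM2r ?powR_gt0//.
have -> : `|t| / c = 2 - c^-1.
  by apply: (mulIf cn0); rewrite divfK// mulrBl mulVf// /c; lra.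
lra.
Qed.

(** The convexity gap [h] is positive away from [t = 1], hence bounded below by
    compactness there, while near [t = 1] the left-hand side is below [e] by itself. *)
Lemma uniform_convexity_powR_unit q e : 1 < q -> 0 < e -> exists2 C : R, 0 <= C &
  forall t, -1 <= t <= 1 ->
  `|1 - t| `^ q <= e * (1 + `|t| `^ q)
                   + C * ((1 + `|t| `^ q) / 2 - `|(1 + t) / 2| `^ q).
Proof.
move=> q1 e0; have q0 : 0 < q by exact: lt_trans q1.
(* [1 - t <= d] forces [(1 - t) `^ q <= e] *)
pose d := Num.min 1 (e `^ q^-1).
have d0 : 0 < d by rewrite lt_min ltr01 powR_gt0.
pose h t := (1 + `|t| `^ q) / 2 - `|(1 + t) / 2| `^ q.
have ch : continuous h.
  have cq := continuous_norm_powR q0.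
  move=> t; apply: cvgB.
    by apply: cvgMl; apply: cvgD; [exact: cvg_cst|exact: cq].
  apply: (@continuous_comp R R R (fun t => (1 + t) / 2) (fun t => `|t| `^ q)); last exact: cq.
  by apply: cvgMl; apply: cvgD; [exact: cvg_cst|exact: cvg_id].
have d1 : d <= 1 by rewrite ge_min lexx.
have [|c] := @EVT_min R h (-1) (1 - d) _ (continuous_subspaceT ch).
  by lra.
rewrite in_itv/= => /andP[cN1 cd] hmin.
have hc : 0 < h c by rewrite subr_gt0 powR_midpoint_lt// cN1 (le_lt_trans cd)// ltrBlDr ltrDl.
have h_ge0 t : -1 <= t <= 1 -> 0 <= h t.
  move=> /andP[tN1]; rewrite le_eqVlt => /predU1P[->|t1].
    by rewrite /h normr1 powR1 (_ : (1 + 1) / 2 = 1) ?normr1 ?powR1; lra.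
  by rewrite subr_ge0 ltW// powR_midpoint_lt// tN1.
exists (2 `^ q / h c) => [|t /andP[tN1 t1]].
  by rewrite divr_ge0 ?powR_ge0// ltW.
rewrite -/(h t).
have [td|td] := leP t (1 - d).
  rewrite -[leLHS]add0r lerD//.
    by rewrite mulr_ge0 ?addr_ge0 ?powR_ge0 ?ltW.
  apply: (@le_trans _ _ (2 `^ q)).
    by apply: ge0_ler_powR; rewrite ?nnegrE ?(ltW q0)// ger0_norm; lra.
  rewrite -mulrA ler_peMr ?powR_ge0// mulrC ler_pdivlMr// mul1r.
  by apply: hmin; rewrite in_itv/= tN1.
rewrite -[leLHS]addr0 lerD//.
  rewrite -[leLHS]mulr1 ler_pM ?powR_ge0 ?lerDl ?powR_ge0//.
  rewrite [leRHS](_ : e = (e `^ q^-1) `^ q); last by rewrite -powRrM mulVf ?gt_eqF// powRr1// ltW.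
  apply: ge0_ler_powR; rewrite ?nnegrE ?powR_ge0 ?(ltW q0)//.
  apply: (@le_trans _ _ d); last by rewrite ge_min lexx orbT.
  by rewrite ger0_norm; lra.
by rewrite mulr_ge0 ?divr_ge0 ?powR_ge0 ?(ltW hc)// h_ge0// tN1.
Qed.

(** A pointwise substitute for Clarkson's inequalities that treats all [q > 1] at once:
    up to a small multiple of the total mass, the distance is controlled by the
    convexity gap at the midpoint. Both sides are homogeneous of degree [q], so the
    larger of [a] and [b] may be scaled to [1]. *)
Lemma uniform_convexity_powR q e : 1 < q -> 0 < e -> exists2 C : R, 0 <= C &
  forall a b, `|a - b| `^ q <= e * (`|a| `^ q + `|b| `^ q)
    + C * ((`|a| `^ q + `|b| `^ q) / 2 - `|(a + b) / 2| `^ q).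
Proof.
move=> q1 e0; have [C C0 HC] := uniform_convexity_powR_unit q1 e0.
have q0 : 0 < q by exact: lt_trans q1.
exists C => // a b; wlog ba : a b / `|b| <= `|a|.
  move=> H; have [/H//|/ltW/H] := leP `|b| `|a|.
  by rewrite distrC (addrC b a) (addrC (`|b| `^ q)).
have [a0|a0] := eqVneq a 0.
  have -> : b = 0 by apply/eqP; rewrite -normr_le0 (le_trans ba)// a0 normr0.
  by rewrite a0 subrr addr0 mul0r normr0 powR0 ?gt_eqF// addr0 mul0r subr0 !mulr0 addr0.
have /HC : -1 <= b / a <= 1.
  by rewrite -ler_norml normrM normfV ler_pdivrMr ?normr_gt0// mul1r.
have aq : 0 < `|a| `^ q by rewrite powR_gt0// normr_gt0.
rewrite -(ler_pM2l aq) mulrDr [X in _ <= X + _]mulrCA [X in _ <= _ + X]mulrCA mulrBr.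
rewrite [X in _ <= _ + C * (X - _)]mulrA mulrDr mulr1 -!powRM// -!normrM.
have -> : a * (b / a) = b by rewrite mulrC divfK.
have -> : a * ((1 + b / a) / 2) = (a + b) / 2.
  by rewrite mulrA mulrDr mulr1 mulrCA divff// mulr1.
by have -> : a * (1 - b / a) = a - b by rewrite mulrBr mulr1 mulrCA divff// mulr1.
Qed.

End uniform_convexity.

(** * The spaces L^q over a finite measure *)

Section ae_series.
Context d (T : measurableType d) (R : realType) (mu : {measure set T -> \bar R}).

(** By monotone convergence the sum of the [|h k|] is integrable, hence finite almost
    everywhere. *)
Lemma ae_cvg_series (h : (T -> R)^nat) :
  (forall k, measurable_fun setT (h k)) ->
  (\sum_(k <oo) \int[mu]_x (`|h k x|)%:E < +oo)%E ->
  \forall x \ae mu, cvgn (series (h^~ x)).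
Proof.
move=> mh hoo.
have mah k : measurable_fun setT (fun x => (`|h k x|)%:E).
  by apply/measurable_EFinP; exact: measurableT_comp.
have int_sum : mu.-integrable setT (fun x => (\sum_(k <oo) (`|h k x|)%:E)%E).
  apply/integrableP; split; first exact: ge0_emeasurable_sum.
  under eq_integral => x _ do rewrite gee0_abs ?nneseries_ge0//.
  by rewrite integral_nneseries.
apply: filterS (integrable_ae measurableT int_sum) => x /(_ I) xfin.
apply: normed_cvg; apply: nondecreasing_is_cvgn.
  by apply: (@nondecreasing_series _ _ xpredT) => k _ _ /=.
exists (fine (\sum_(k <oo) (`|h k x|)%:E)%E) => _ [n _ <-].
rewrite -lee_fin fineK// /series/= -sumEFin.
exact: nneseries_lim_ge.
Qed.

End ae_series.

Section Lq.
Context d (T : measurableType d) (R : realType) (mu : {measure set T -> \bar R}).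
Context (q : R) (q1 : 1 < q).
Local Notation Lq := (Lfun mu q%:E).
Implicit Types f g : T -> R.

Let q0 : 0 < q. Proof. exact: lt_trans q1. Qed.

(** The [q]-th power of the norm is additive over the domain, so pointwise
    inequalities between powers integrate directly; the norm itself only matters when
    meeting the topology of the space. *)
Definition Lq_energy f : R := \int[mu]_x (`|f x| `^ q).

Lemma Lq_measurable f : f \in Lq -> measurable_fun setT f.
Proof. by rewrite inE => /andP[]; rewrite inE. Qed.

Lemma measurable_norm_powR f : measurable_fun setT f ->
  measurable_fun setT (fun x => (`|f x| `^ q)%:E).
Proof.
move=> mf; apply/measurable_EFinP; apply: (measurableT_comp (measurable_powR _)).
exact: measurableT_comp.
Qed.

Lemma Lq_integrable f : f \in Lq -> mu.-integrable setT (fun x => (`|f x| `^ q)%:E).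
Proof. exact: Lfun_integrable (ltW q1). Qed.

Lemma Lnorm_energy f : f \in Lq -> ('N[mu]_q%:E[EFin \o f] `^ q = (Lq_energy f)%:E)%E.
Proof.
move=> fL; rewrite poweR_Lnorm ?gt_eqF// /Lq_energy /Rintegral fineK//.
by apply: integrable_fin_num => //; exact: Lq_integrable.
Qed.

Lemma LqP f : measurable_fun setT f ->
  (\int[mu]_x (`|f x| `^ q)%:E < +oo)%E -> f \in Lq.
Proof.
move=> mf foo; rewrite inE; apply/andP; split; first by rewrite inE.
by rewrite inE /= /finite_norm unlock poweR_lty.
Qed.

Lemma Lq_energyE f : f \in Lq -> (Lq_energy f)%:E = (\int[mu]_x (`|f x| `^ q)%:E)%E.
Proof.
move=> fL; rewrite /Lq_energy /Rintegral fineK//.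
by apply: integrable_fin_num => //; exact: Lq_integrable.
Qed.

Lemma Lq_lincomb a b f g : f \in Lq -> g \in Lq -> (fun x => a * f x + b * g x) \in Lq.
Proof.
have [L0 Llin] := @Lfun_submod_closed _ _ _ mu _ (exponent_ge1 q1).
move=> fL gL; have bg := Llin b g 0 gL L0.
have := Llin a f _ fL bg; rewrite addr0.
by rewrite (_ : a *: f + b *: g = fun x => a * f x + b * g x).
Qed.

Lemma Lq_sub f g : f \in Lq -> g \in Lq -> (fun x => f x - g x) \in Lq.
Proof.
move=> fL gL; rewrite (_ : (fun x => _) = fun x => 1 * f x + -1 * g x); first exact: Lq_lincomb.
by apply/funext => x; rewrite mul1r mulN1r.
Qed.

Lemma Lq_energy_ge0 f : 0 <= Lq_energy f.
Proof. by apply: Rintegral_ge0 => x _; exact: powR_ge0. Qed.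

(** Integrated over a finite measure, this bounds the L^1 norm by the energy up to an
    arbitrarily small additive error. *)
Lemma norm_le_powR (e t : R) : 0 < e -> `|t| <= e + e `^ (1 - q) * `|t| `^ q.
Proof.
move=> e0; have [te|te] := leP `|t| e.
  by rewrite (le_trans te)// lerDl mulr_ge0 ?powR_ge0.
rewrite -[leLHS]add0r lerD ?(ltW e0)//.
rewrite -(mulr_powRB1 (normr_ge0 t) q0) mulrCA -[leLHS]mulr1 ler_wpM2l//.
rewrite -opprB powRN mulrC ler_pdivlMr ?powR_gt0// mul1r.
by apply: ge0_ler_powR; rewrite ?nnegrE ?subr_ge0 ?normr_ge0 ?(ltW e0) ?(ltW q1) ?(ltW te).
Qed.

Section finite.
Hypothesis muT : (mu setT < +oo)%E.

Let mu_fin : mu setT \is a fin_num.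
Proof. by rewrite ge0_fin_numE. Qed.

Lemma Lq_integrable1 f : f \in Lq -> mu.-integrable setT (EFin \o f).
Proof.
move=> fL; apply/Lfun1_integrable.
by apply: (Lfun_subset (lexx 1%E) (exponent_ge1 q1) mu_fin) fL; rewrite lee_fin ltW.
Qed.

Lemma L1_le_energy e f : 0 < e -> f \in Lq ->
  \int[mu]_x `|f x| <= e * fine (mu setT) + e `^ (1 - q) * Lq_energy f.
Proof.
move=> e0 fL; have iq := Lq_integrable fL.
have ic : mu.-integrable setT (EFin \o (fun=> e) : T -> \bar R).
  apply/integrableP; split; first exact/measurable_EFinP/measurable_cst.
  by under eq_integral do rewrite /=; rewrite integral_cst//= lte_mul_pinfty.
have iz : mu.-integrable setT (EFin \o (fun x => e `^ (1 - q) * `|f x| `^ q)).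
  exact: (integrableZl measurableT (e `^ (1 - q)) iq).
rewrite -Rintegral_cst// -RintegralZl// -RintegralD//.
apply: le_Rintegral => //.
- exact/integrable_norm/Lq_integrable1.
- exact: (integrableD measurableT ic iz).
- by move=> x _; exact: norm_le_powR.
Qed.

End finite.
End Lq.

Lemma limn_einf_le (R : realType) (u : (\bar R)^nat) (l : \bar R) n :
  (forall k, (n <= k)%N -> (u k <= l)%E) -> (limn_einf u <= l)%E.
Proof.
move=> ul; rewrite limn_einf_lim; apply: lime_le; first exact: is_cvg_einfs.
apply: nearW => m; apply: (@le_trans _ _ (u (maxn m n))).
  by apply: ereal_inf_lbound; exists (maxn m n) => //=; rewrite leq_maxl.
by rewrite ul// leq_maxr.
Qed.

Section Lq_complete.
Context d (T : measurableType d) (R : realType) (mu : {measure set T -> \bar R}).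
Context (q : R) (q1 : 1 < q) (muT : (mu setT < +oo)%E).
Local Notation Lq := (Lfun mu q%:E).
Local Notation energy := (Lq_energy mu q).
Implicit Types f g : T -> R.

Let q0 : 0 < q. Proof. exact: lt_trans q1. Qed.

Lemma Lq_L1_small (e : R) : 0 < e -> exists2 c : R, 0 < c &
  forall f, f \in Lq -> energy f <= c -> \int[mu]_x `|f x| <= e.
Proof.
move=> e0; set m := fine (mu setT).
have m0 : 0 <= m by exact: fine_ge0.
pose a := e / 2 / (m + 1).
have a0 : 0 < a by rewrite !divr_gt0// ltr_wpDl.
exists (e / 2 / a `^ (1 - q)); first by rewrite !divr_gt0// powR_gt0.
move=> f fL fc; rewrite (le_trans (L1_le_energy q1 muT a0 fL))// [leRHS]splitr lerD//.
  by rewrite /a mulrAC ler_pdivrMr ?ltr_wpDl// ler_pM2l ?divr_gt0// lerDl.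
by rewrite mulrC -ler_pdivlMr ?powR_gt0.
Qed.

(** Since the measure is finite, a Cauchy sequence of L^q is Cauchy in L^1, and a
    subsequence with summable L^1 increments converges almost everywhere. Fatou's
    lemma then turns the Cauchy bounds into bounds on the distance to the pointwise
    limit. *)
Lemma Lq_complete (f : (T -> R)^nat) : (forall k, f k \in Lq) ->
  (forall e : R, 0 < e -> exists n, forall j k, (n <= j)%N -> (n <= k)%N ->
    energy (fun x => f j x - f k x) <= e) ->
  exists2 g, g \in Lq & forall e : R, 0 < e -> exists n, forall k, (n <= k)%N ->
    energy (fun x => f k x - g x) <= e.
Proof.
move=> fL f_cauchy.
have mf k : measurable_fun setT (f k) by exact: Lq_measurable (fL k).
have fB j k : (fun x => f j x - f k x) \in Lq by exact: Lq_sub.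
have /choice[N HN] k : exists n, forall i j, (n <= i)%N -> (n <= j)%N ->
    \int[mu]_x `|f i x - f j x| <= 1 / (2 ^ (k + 1))%:R.
  have [|c c0 Hc] := @Lq_L1_small (1 / (2 ^ (k + 1))%:R).
    by rewrite divr_gt0// ltr0n expn_gt0.
  have [n Hn] := f_cauchy _ c0.
  by exists n => i j ni nj; apply: (Hc _ (fB i j)); exact: Hn.
(* The index [s k] is beyond [N k], for the summability of the increments, and beyond
   [k], so that the subsequence eventually passes every index. *)
pose s k := (\max_(i < k.+1) maxn (N i) i)%N.
have sN i k : (i <= k)%N -> (maxn (N i) i <= s k)%N.
  rewrite -ltnS => ik.
  exact: (@leq_bigmax _ (fun i : 'I_k.+1 => maxn (N i) i) (Ordinal ik)).
pose h k x := f (s k.+1) x - f (s k) x.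
have mh k : measurable_fun setT (h k) by apply: measurable_funB.
have hoo : (\sum_(k <oo) \int[mu]_x (`|h k x|)%:E < +oo)%E.
  apply: (@le_lt_trans _ _ (\sum_(k <oo) (1 / (2 ^ (k + 1))%:R)%:E)%E).
    apply: lee_nneseries => k _; first by move=> _; exact: integral_ge0.
    rewrite -[leLHS]fineK; last first.
      apply: integrable_fin_num => //.
      exact: (integrable_norm (Lq_integrable1 q1 muT (fB _ _))).
    rewrite lee_fin; apply: HN.
      by rewrite (leq_trans (leq_maxl _ k))// sN.
    by rewrite (leq_trans (leq_maxl _ k))// sN.
  by have /cvg_lim -> := @cvg_geometric_eseries_half R 1 0; rewrite ?ltry.
have ae_cvg := ae_cvg_series mh hoo.
(* The upper limit is measurable even where the subsequence diverges. *)
pose g x := fine (limn_esup (fun k => (f (s k) x)%:E)).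
have mg : measurable_fun setT g.
  apply: measurableT_comp => //.
  apply: (@measurable_fun_limn_esup _ _ _ setT (fun k x => (f (s k) x)%:E)).
  by move=> k; exact/measurable_EFinP.
have fg : \forall x \ae mu, f (s k) x @[k --> \oo] --> g x.
  apply: filterS ae_cvg => x hx.
  have /cvg_ex[l fl] : cvgn (fun k => f (s k) x).
    have -> : (fun k => f (s k) x) = (fun k => series (h^~ x) k + f (s 0) x).
      apply/funext => k; rewrite /series/= telescope_sumr ?subrK//.
    exact: is_cvgD (hx) (is_cvg_cst _).
  rewrite /g; have /cvg_limn_einf_sup[_ ->] //: (f (s k) x)%:E @[k --> \oo] --> l%:E.
  by apply: cvg_EFin => //; exact: nearW.
have gj e n : 0 < e -> (forall j k, (n <= j)%N -> (n <= k)%N ->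
    energy (fun x => f j x - f k x) <= e) -> forall j, (n <= j)%N ->
    (\int[mu]_x (`|f j x - g x| `^ q)%:E <= e%:E)%E.
  move=> e0 Hn j nj.
  pose F k x := (`|f j x - f (s k) x| `^ q)%:E.
  have mF k : measurable_fun setT (F k).
    by apply: measurable_norm_powR; apply: measurable_funB.
  have mG : measurable_fun setT (fun x => (`|f j x - g x| `^ q)%:E).
    by apply: measurable_norm_powR; apply: measurable_funB.
  have mlF : measurable_fun setT (fun x => limn_einf (F^~ x)).
    under eq_fun do rewrite -[limn_einf _]oppeK -limn_esupN.
    apply: measurableT_comp => //.
    apply: (@measurable_fun_limn_esup _ _ _ setT (fun k x => - F k x)%E) => k.
    exact: measurableT_comp.
  rewrite (@ae_eq_integral _ _ _ mu setT (fun x => limn_einf (F^~ x)))//; last first.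
    apply: filterS fg => x fgx _; apply/esym.
    have /cvg_limn_einf_sup[-> _] // : F k x @[k --> \oo] --> (`|f j x - g x| `^ q)%:E.
    apply: cvg_EFin; first exact: nearW.
    apply: (@continuous_cvg _ _ _ _ _ _ (fun t => `|t| `^ q)).
      exact: continuous_norm_powR.
    by apply: cvgB => //; exact: cvg_cst.
  apply: (le_trans (fatou mu measurableT mF _)).
    by move=> k x _; rewrite lee_fin powR_ge0.
  apply: (@limn_einf_le _ _ _ n) => k nk; rewrite -Lq_energyE// lee_fin Hn//.
  by rewrite (leq_trans nk)// (leq_trans (leq_maxr (N k) k))// sN.
have gL : g \in Lq.
  have [n Hn] := f_cauchy 1 ltr01.
  have gfL : (fun x => f n x - g x) \in Lq.
    apply: LqP; first exact: measurable_funB.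
    by rewrite (le_lt_trans (gj _ _ ltr01 Hn _ (leqnn n)))// ltry.
  rewrite (_ : g = fun x => f n x - (f n x - g x)); first exact: Lq_sub.
  by apply/funext => x; rewrite subKr.
exists g => // e e0; have [n Hn] := f_cauchy _ e0; exists n => k nk.
by rewrite -lee_fin Lq_energyE ?Lq_sub//; exact: gj Hn _ nk.
Qed.

End Lq_complete.

Lemma mulr_half_quarter (R : realFieldType) (x y : R) :
  0 < x -> x * (2 * (y / (4 * x))) = y / 2.
Proof.
move=> x0; have xn0 : x != 0 by rewrite gt_eqF.
have -> : x * (2 * (y / (4 * x))) = 2 * (y / 4) * (x / x) by rewrite invfM; lra.
by rewrite divff//; lra.
Qed.

Section Lq_nested.
Context d (T : measurableType d) (R : realType) (mu : {measure set T -> \bar R}).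
Context (q : R) (q1 : 1 < q).
Local Notation Lq := (Lfun mu q%:E).
Local Notation L := (LspaceType mu (exponent_ge1 q1)).
Local Notation energy := (Lq_energy mu q).
Implicit Types f g : T -> R.

Let q0 : 0 < q. Proof. exact: lt_trans q1. Qed.

Lemma Lspace_Lfun (u : L) : (u : T -> R) \in Lq.
Proof.
rewrite inE; apply/andP; split; rewrite inE; last exact: Lebesgue_finite.
have mu_u : measurable_fun setT (u : T -> measurableTypeR R) by exact: measurable_funPT.
exact: mu_u.
Qed.

Lemma Lq_energy_ae f g : measurable_fun setT f -> measurable_fun setT g ->
  f = g %[ae mu] -> energy f = energy g.
Proof.
move=> mf mg fg; congr fine; apply: ae_eq_integral => //.
- exact: measurable_norm_powR.
- exact: measurable_norm_powR.
- by apply: filterS fg => x /(_ I) /= ->.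
Qed.

Lemma Lq_uniform_convexity (e : R) : 0 < e -> exists2 C : R, 0 <= C &
  forall f g, f \in Lq -> g \in Lq ->
  energy (fun x => f x - g x) <= e * (energy f + energy g)
    + C * ((energy f + energy g) / 2 - energy (fun x => (f x + g x) / 2)).
Proof.
move=> e0; have [C C0 HC] := uniform_convexity_powR q1 e0.
exists C => // f g fL gL.
have hL : (fun x => (f x + g x) / 2) \in Lq.
  rewrite (_ : (fun x => _) = fun x => 2^-1 * f x + 2^-1 * g x).
    exact: Lq_lincomb.
  by apply/funext => x; rewrite mulrDl mulrC [g x / 2]mulrC.
have If := Lq_integrable q1 fL; have Ig := Lq_integrable q1 gL.
have Ih := Lq_integrable q1 hL; have Ifg := Lq_integrable q1 (Lq_sub q1 fL gL).
have IZ a (k : T -> R) : mu.-integrable setT (EFin \o k) ->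
    mu.-integrable setT (EFin \o (fun x => a * k x)).
  by move=> Ik; exact: (integrableZl measurableT a Ik).
have ID (k l : T -> R) : mu.-integrable setT (EFin \o k) ->
    mu.-integrable setT (EFin \o l) ->
    mu.-integrable setT (EFin \o (fun x => k x + l x)).
  by move=> Ik Il; exact: (integrableD measurableT Ik Il).
have Is := ID _ _ If Ig.
have Ih' := IZ (- C) _ Ih.
rewrite [leRHS](_ : _ = (e + C / 2) * (energy f + energy g)
    + - C * energy (fun x => (f x + g x) / 2)); last first.
  by move: (energy f) (energy g) (energy _) => a b c; lra.
rewrite /Lq_energy -RintegralD// -RintegralZl// -[X in _ <= _ + X]RintegralZl//.
rewrite -RintegralD//; last exact: IZ.
apply: le_Rintegral => //; first by apply: ID => //; exact: IZ.
by move=> x _; apply: le_trans (HC (f x) (g x)) _; lra.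
Qed.

(** Reflexivity in Smulian's form. Let [D] be the limit of the minimal energies of the
    sets [C n]. Elements [s n] of [C n] of energy close to [D] have midpoints in the
    same sets, hence of energy not much below [D], so uniform convexity makes the
    sequence [s] Cauchy; its limit lies in every [C n]. *)
Lemma nested_closed_convex (muT : (mu setT < +oo)%E) (C : nat -> set L) (r : R) :
  (forall n, C n !=set0) ->
  (forall m n, (m <= n)%N -> C n `<=` C m) ->
  (forall u, C 0 u -> energy u <= r) ->
  (forall n u v w, C n u -> C n v -> is_convex_comb 2^-1 u v w -> C n w) ->
  (forall n (s : nat -> L) (u : L), (forall k, C n (s k)) ->
    (forall e : R, 0 < e -> exists m, forall k, (m <= k)%N ->
      energy (fun x => s k x - u x) <= e) -> C n u) ->
  exists u, forall n, C n u.
Proof.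
move=> C0 Cdec Cbnd Cconv Cclosed.
pose B := [set a : R | exists n, forall u, C n u -> a <= energy u].
have Bsup : has_sup B.
  split; first by exists 0; exists 0%N => u _; exact: Lq_energy_ge0.
  exists r => a [n Hn]; have [u Cu] := C0 n; rewrite (le_trans (Hn u Cu))//.
  by apply: Cbnd; exact: Cdec (leq0n n) _ Cu.
set D := sup B.
have D0 : 0 <= D.
  by apply: ub_le_sup; [case: Bsup|exists 0%N => u _; exact: Lq_energy_ge0].
(* [D] is approached from below by lower bounds of the energy on some [C n], and no
   larger number is such a bound. *)
have D_lower e : 0 < e -> exists n, forall u, C n u -> D - e <= energy u.
  move=> e0; have [a [n Hn] Da] := sup_adherent e0 Bsup.
  by exists n => u /Hn; apply: le_trans; exact: ltW.
have /choice[s Hs] n : exists u, C n u /\ energy u < D + n.+1%:R^-1.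
  apply: contrapT => H.
  have : B (D + n.+1%:R^-1).
    exists n => u Cu; rewrite leNgt; apply/negP => uD.
    by apply: H; exists u.
  case: Bsup => _ Bub /(ub_le_sup Bub).
  by rewrite -/D leNgt ltrDl invr_gt0 ltr0Sn.
have sL k : (s k : T -> R) \in Lq by exact: Lspace_Lfun.
have sC n k : (n <= k)%N -> C n (s k) by move=> nk; apply: (Cdec _ _ nk); case: (Hs k).
have s_cauchy (e : R) : 0 < e -> exists n, forall j k, (n <= j)%N -> (n <= k)%N ->
    energy (fun x => s j x - s k x) <= e.
  move=> e0.
  have e1 : 0 < e / (4 * (D + 1)) by rewrite divr_gt0// mulr_gt0// ltr_wpDl.
  have [K K0 HK] := Lq_uniform_convexity e1.
  pose h := Num.min 1 (e / (4 * (K + 1))).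
  have h0 : 0 < h by rewrite lt_min ltr01 divr_gt0// mulr_gt0// ltr_wpDl.
  have h1 : h <= 1 by rewrite ge_min lexx.
  have hK : K * (2 * h) <= e / 2.
    apply: (@le_trans _ _ ((K + 1) * (2 * (e / (4 * (K + 1)))))).
      rewrite ler_pM ?mulr_ge0 ?(ltW h0)// ?lerDl// ler_pM2l//.
      by rewrite ge_min lexx orbT.
    by rewrite mulr_half_quarter// ltr_wpDl.
  have [n1 Hn1] := D_lower _ h0.
  have [n2 Hn2] : exists n, n.+1%:R^-1 <= h.
    exists (Num.truncn h^-1); rewrite invf_ple ?posrE//.
    by rewrite ltW// truncnS_gt.
  exists (maxn n1 n2) => j k.
  rewrite !geq_max => /andP[j1 j2] /andP[k1 k2].
  have small i : (n2 <= i)%N -> energy (s i) <= D + h.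
    move=> ni; have [_ /ltW/le_trans] := Hs i; apply; rewrite lerD2l (le_trans _ Hn2)//.
    by rewrite lef_pV2 ?posrE// ler_nat.
  have [w Hw] : exists w : L, is_convex_comb 2^-1 (s j) (s k) w.
    by have := Lspace_repr (exponent_ge1 q1) (Lq_lincomb q1 2^-1 (1 - 2^-1) (sL j) (sL k)).
  have Cw := Cconv n1 _ _ _ (sC _ _ j1) (sC _ _ k1) Hw.
  have wE : energy w = energy (fun x => (s j x + s k x) / 2).
    apply: Lq_energy_ae.
    - exact: (Lq_measurable (Lspace_Lfun w)).
    - by apply: measurable_funM => //; apply: measurable_funD; exact: (Lq_measurable (sL _)).
    - by apply: filterS Hw => x /(_ I) ->; lra.
  apply: (le_trans (HK _ _ (sL j) (sL k))).
  rewrite -wE.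
  have := Hn1 _ Cw; have := small _ j2; have := small _ k2.
  move: (energy w) (energy (s j)) (energy (s k)) => a b c ca ba aD.
  rewrite [leRHS]splitr; apply: lerD.
    apply: (@le_trans _ _ (e / (4 * (D + 1)) * (2 * (D + 1)))).
      by rewrite ler_pM2l//; clear - ba ca h1; lra.
    by rewrite mulrC -mulrA mulrCA mulr_half_quarter// ltr_wpDl.
  by apply: le_trans hK; rewrite ler_wpM2l//; clear - ba ca aD; lra.
have [g gL sg] := Lq_complete q1 muT sL s_cauchy.
have [u ug] := Lspace_repr (exponent_ge1 q1) gL.
exists u => n; apply: (Cclosed n (fun k => s (n + k)%N)) => [k|e e0].
  by apply: sC; exact: leq_addr.
have [m Hm] := sg _ e0; exists m => k mk.
rewrite (_ : energy _ = energy (fun x => s (n + k)%N x - g x)).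
  by rewrite Hm// (leq_trans mk)// leq_addl.
apply: Lq_energy_ae.
- by apply: measurable_funB; [exact: (Lq_measurable (sL _))|exact: (Lq_measurable (Lspace_Lfun u))].
- by apply: measurable_funB; [exact: (Lq_measurable (sL _))|exact: (Lq_measurable gL)].
- by apply: filterS ug => x /(_ I) ->.
Qed.

End Lq_nested.

(** * The weighted divergence of an admissible field *)

Lemma open_setX (X Y : topologicalType) (A : set X) (B : set Y) :
  open A -> open B -> open (A `*` B).
Proof.
move=> oA oB; rewrite openE => -[x y] [Ax By]; exists (A, B) => //=.
by split; exact: open_nbhs_nbhs.
Qed.

Section rV_product_borel.
Context {R : realType} {n m : nat}.

Lemma rat_rV_dense k (x : 'rV[R]_k) (r : R) : 0 < r ->
  exists a : 'rV[rat]_k, ball (map_mx ratr a : 'rV[R]_k) r x.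
Proof.
move=> r0.
have xq i : exists a : rat, ratr a \in `](x 0 i - r : R), (x 0 i + r)[.
  by apply: rat_in_itvoo; rewrite ltrBlDr -addrA ltrDl addr_gt0.
have {xq}[a xa] := choice xq.
exists (\row_i a i); split => // i j; rewrite !mxE (ord1 i) /ball/=.
by move: (xa j); rewrite in_itv/= ltr_distl => /andP[-> ->].
Qed.

(** The product sigma-algebra is only generated by measurable rectangles; an open set
    belongs to it because it is a countable union of products of rational balls. *)
Lemma open_measurable_rV_prod (U : set ('rV[R]_n * 'rV[R]_m)) :
  open U -> measurable U.
Proof.
move=> oU.
pose B (p : 'rV[rat]_n * 'rV[rat]_m * rat) : set ('rV[R]_n * 'rV[R]_m) :=
  ball (map_mx ratr p.1.1 : 'rV[R]_n) (ratr p.2) `*` ball (map_mx ratr p.1.2 : 'rV[R]_m) (ratr p.2).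
have -> : U = \bigcup_p (if `[< 0 < p.2 /\ B p `<=` U >] then B p else set0).
  apply/seteqP; split => [x Ux|x [p _]]; last by case: asboolP => // -[_ +] ?; exact.
  have : nbhs x U by exact: open_nbhs_nbhs.
  rewrite -nbhs_ballE => -[e /= e0 xeU].
  have [r] : exists r : rat, ratr r \in `](0:R), e / 2[.
    by apply: rat_in_itvoo; rewrite divr_gt0.
  rewrite in_itv/= => /andP[r0 re].
  have [a xa] := rat_rV_dense x.1 r0.
  have [b xb] := rat_rV_dense x.2 r0.
  exists (a, b, r) => //; case: asboolP => // -[]; split => /=.
    by rewrite -(@ltr0q R).
  move=> y [/= ya yb]; apply: xeU; split; rewrite (splitr e).
    apply: (@ball_triangle _ _ (map_mx ratr a : 'rV[R]_n));
      by apply: le_ball (ltW re) _ _ => //; exact: ball_sym.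
  apply: (@ball_triangle _ _ (map_mx ratr b : 'rV[R]_m));
    by apply: le_ball (ltW re) _ _ => //; exact: ball_sym.
apply: countable_bigcupT_measurable; first exact: countableP.
move=> p; case: asboolP => // -[p0 _].
have p0' : 0 < ratr p.2 :> R by rewrite ltr0q.
by apply: measurableX; apply: open_measurable_rV; exact: ball_open.
Qed.

Lemma continuous_on_open_measurable_fun (O : set ('rV[R]_n * 'rV[R]_m))
    (g : 'rV[R]_n * 'rV[R]_m -> R) :
  open O -> (forall p, O p -> {for p, continuous g}) -> measurable_fun O g.
Proof.
move=> oO cg; apply: (measurability _ (RGenOInfty.measurableE R)) => _ [_ [a ->] <-].
apply: open_measurable_rV_prod; rewrite openE => p [Op gp].
rewrite /interior; apply: filterI; first exact: open_nbhs_nbhs.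
by apply: cg => //; apply: open_nbhs_nbhs; split => //; exact: interval_open.
Qed.

End rV_product_borel.

Lemma derive_mul_sub (R : realType) (W : normedModType R) (a b c : W -> R)
    (x v : W) (a' b' c' : R) :
  derivable a x v -> derivable b x v -> derivable c x v ->
  derive a x v = a' -> derive b x v = b' -> derive c x v = c' ->
  derive (fun z => a z * (b z - c z)) x v = a x * (b' - c') + (b x - c x) * a'.
Proof.
move=> da db dc <- <- <-; have dbc := derivableB db dc.
by rewrite -(deriveB db dc) -[RHS](deriveM da dbc).
Qed.

Section nonlocal_divergence.
Context {R : realType} {N : nat} (Omega : set 'rV[R]_N).
Local Notation V := 'rV[R]_N.
Hypothesis oOmega : open Omega.
Context (w : V * V -> R) (phi : V * V -> V).
Hypothesis w_C1 : C1_on (Omega `*` Omega) w.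
Hypothesis phi_C1c : C1c_field Omega phi.

Let e_ (i : 'I_N) : V := delta_mx 0 i.
Let swap (p : V * V) : V * V := (p.2, p.1).

Definition nonlocal_integrand (p : V * V) : R :=
  divergence (fun z => w (z, p.2) *: (phi (p.2, z) - phi (z, p.2))) p.1.

(** Along a direction tangent to a slice, the two difference quotients are the same
    function, so no chain rule is involved. *)
Lemma derive_pair1 (W : normedModType R) (f : V * V -> W) (x y v : V) :
  derive (fun z => f (z, y)) x v = derive f (x, y) (v, 0) /\
  (derivable (fun z => f (z, y)) x v <-> derivable f (x, y) (v, 0)).
Proof.
rewrite /derive /derivable /=.
suff -> : (fun h : R => h^-1 *: (((fun z => f (z, y)) \o shift x) (h *: v) - f (x, y))) =
  (fun h : R => h^-1 *: ((f \o shift (x, y)) (h *: (v, 0 : V)) - f (x, y))) by [].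
apply/funext => h; congr (_ *: (f _ - _)).
by congr pair; rewrite /= scaler0 add0r.
Qed.

Lemma derive_pair2 (W : normedModType R) (f : V * V -> W) (x y v : V) :
  derive (fun z => f (y, z)) x v = derive f (y, x) (0, v) /\
  (derivable (fun z => f (y, z)) x v <-> derivable f (y, x) (0, v)).
Proof.
rewrite /derive /derivable /=.
suff -> : (fun h : R => h^-1 *: (((fun z => f (y, z)) \o shift x) (h *: v) - f (y, x))) =
  (fun h : R => h^-1 *: ((f \o shift (y, x)) (h *: (0 : V, v)) - f (y, x))) by [].
apply/funext => h; congr (_ *: (f _ - _)).
by congr pair; rewrite /= scaler0 add0r.
Qed.

(** The divergence differentiates only the first variable of the flux; this product
    rule expresses it through the differentials of [w] and [phi] on the product, whose
    continuity is what the C^1 assumptions provide. *)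
Lemma derive_nonlocal_flux (x y v : V) (i : 'I_N) : Omega x -> Omega y ->
  derive (fun z => (w (z, y) *: (phi (y, z) - phi (z, y))) 0 i) x v =
  w (x, y) * ('d phi (y, x) (0, v) 0 i - 'd phi (x, y) (v, 0) 0 i)
  + (phi (y, x) 0 i - phi (x, y) 0 i) * 'd w (x, y) (v, 0).
Proof.
move=> Ox Oy; have [[phi_d _] _ _] := phi_C1c; have [w_d _] := w_C1.
have phixy : differentiable phi (x, y) by exact: phi_d.
have phiyx : differentiable phi (y, x) by exact: phi_d.
have wxy : differentiable w (x, y) by exact: w_d.
have -> : (fun z => (w (z, y) *: (phi (y, z) - phi (z, y))) 0 i) =
    (fun z => w (z, y) * (phi (y, z) 0 i - phi (z, y) 0 i)).
  by apply/funext => z; rewrite !mxE.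
have [Dw [_ dw]] := derive_pair1 w x y v.
have [Dphi1 [_ dphi1]] := derive_pair1 phi x y v.
have [Dphi2 [_ dphi2]] := derive_pair2 phi x y v.
have {}dw : derivable (fun z => w (z, y)) x v.
  by apply: dw; exact: diff_derivable.
have {}dphi1 : derivable (fun z => phi (z, y)) x v.
  by apply: dphi1; exact: diff_derivable.
have {}dphi2 : derivable (fun z => phi (y, z)) x v.
  by apply: dphi2; exact: diff_derivable.
have Ew : 'D_(v, 0) w (x, y) = 'd w (x, y) (v, 0) by exact: deriveE.
have E1 : 'D_(v, 0) phi (x, y) = 'd phi (x, y) (v, 0) by exact: deriveE.
have E2 : 'D_(0, v) phi (y, x) = 'd phi (y, x) (0, v) by exact: deriveE.
have c1 := (derivable_mxP _ _ _).1 dphi1 0 i.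
have c2 := (derivable_mxP _ _ _).1 dphi2 0 i.
have F1 : 'D_v (fun z => phi (z, y) 0 i) x = 'd phi (x, y) (v, 0) 0 i.
  by rewrite -E1 -Dphi1 (derive_mx dphi1) mxE.
have F2 : 'D_v (fun z => phi (y, z) 0 i) x = 'd phi (y, x) (0, v) 0 i.
  by rewrite -E2 -Dphi2 (derive_mx dphi2) mxE.
rewrite Ew in Dw.
exact: (derive_mul_sub dw c2 c1 Dw F2 F1).
Qed.

Lemma nonlocal_integrandE p : (Omega `*` Omega) p -> nonlocal_integrand p =
  \sum_(i < N) (w p * ('d phi (swap p) (0, e_ i) 0 i - 'd phi p (e_ i, 0) 0 i)
    + (phi (swap p) 0 i - phi p 0 i) * 'd w p (e_ i, 0)).
Proof.
case: p => x y [/= Ox Oy]; apply: eq_bigr => i _.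
exact: derive_nonlocal_flux.
Qed.

Let swap_cont : continuous swap. Proof. exact: swap_continuous. Qed.

Let open_OO : open (Omega `*` Omega).
Proof. exact: open_setX. Qed.

Lemma nonlocal_integrand_continuous p : (Omega `*` Omega) p ->
  {for p, continuous nonlocal_integrand}.
Proof.
move=> Op; have [Op1 Op2] := Op; have Osp : (Omega `*` Omega) (swap p) by [].
have [[phi_d phi_c] _ _] := phi_C1c; have [w_d w_c] := w_C1.
have coord (F : V * V -> V) r i : {for r, continuous F} -> F q 0 i @[q --> r] --> F r 0 i.
  move=> cF; apply: (@continuous_cvg _ _ _ _ _ F (fun m : V => m 0 i)).
    exact: coord_continuous.
  exact: cF.
have cswap (F : V * V -> R) : F q @[q --> swap p] --> F (swap p) ->
    F (swap q) @[q --> p] --> F (swap p).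
  by apply: cvg_comp; exact: swap_cont.
pose G (q : V * V) := \sum_(i < N) (w q * ('d phi (swap q) (0, e_ i) 0 i - 'd phi q (e_ i, 0) 0 i)
    + (phi (swap q) 0 i - phi q 0 i) * 'd w q (e_ i, 0)).
have GE : \near p, G p = nonlocal_integrand p.
  have : nbhs p (Omega `*` Omega) by exact: open_nbhs_nbhs.
  by apply: filterS => q Oq; rewrite nonlocal_integrandE.
suff Gp : G q @[q --> p] --> G p.
  have GEp := nbhs_singleton GE.
  rewrite /prop_for /continuous_at -GEp; apply: cvg_trans Gp.
  by apply: near_eq_cvg; exact: GE.
apply: cvg_big => [|i _]; first exact: add_continuous.
apply: cvgD.
  apply: cvgM; first exact: differentiable_continuous (w_d _ Op).
  apply: cvgB.
    by apply: (cswap (fun q => 'd phi q (0, e_ i) 0 i)); apply: coord; exact: phi_c.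
  by apply: (coord (fun q => 'd phi q (e_ i, 0))); exact: phi_c.
apply: cvgM; last exact: w_c.
apply: cvgB.
  apply: (cswap (fun q => phi q 0 i)); apply: coord.
  exact: differentiable_continuous (phi_d _ Osp).
by apply: coord; exact: differentiable_continuous (phi_d _ Op).
Qed.

Let supp := closure [set p | phi p != 0].

Lemma nonlocal_integrand_support p : (Omega `*` Omega) p ->
  ~ supp p -> ~ supp (swap p) -> nonlocal_integrand p = 0.
Proof.
have zero r : ~ supp r -> phi r = 0 /\ forall v, (Omega `*` Omega) r -> 'd phi r v = 0.
  move=> nr; have [[phi_d _] _ _] := phi_C1c.
  have nz : \near r, phi r = 0.
    have : nbhs r (~` supp).
      by apply: open_nbhs_nbhs; split => //; apply: closed_openC; exact: closed_closure.
    apply: filterS => s ns; apply: contrapT => /eqP phis; apply: ns.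
    exact: subset_closure.
  split; first exact: nbhs_singleton nz.
  move=> v Or; rewrite -deriveE; last exact: phi_d.
  by rewrite (near_eq_derive _ (_ : \near r, phi r = cst 0 r))// derive_cst.
move=> [Op1 Op2] /zero[p0 dp0] /zero[s0 ds0].
rewrite nonlocal_integrandE// big1// => i _.
have sum0 (a b c b' c' d : R) : b = 0 -> c = 0 -> b' = 0 -> c' = 0 ->
    a * (b - c) + (b' - c') * d = 0.
  by move=> -> -> -> ->; rewrite subrr mulr0 mul0r addr0.
apply: sum0.
- by rewrite (ds0 (0, e_ i) (conj Op2 Op1)) mxE.
- by rewrite (dp0 (e_ i, 0) (conj Op1 Op2)) mxE.
- by rewrite s0 mxE.
- by rewrite p0 mxE.
Qed.

(** The integrand is continuous on [Omega `*` Omega] and vanishes off the support of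
    [phi] and its mirror image under the exchange of variables, which form a compact
    subset of [Omega `*` Omega]. *)
Lemma nonlocal_integrand_bounded : exists2 M : R, 0 <= M &
  forall p, (Omega `*` Omega) p -> `|nonlocal_integrand p| <= M.
Proof.
have [_ cK KO] := phi_C1c.
have cS : compact (supp `|` swap @` supp).
  apply: compactU => //; apply: continuous_compact => //.
  exact: (continuous_subspaceT swap_cont).
have SO : supp `|` swap @` supp `<=` Omega `*` Omega.
  by move=> p [/KO//|[r /KO[r1 r2] <-]]; split.
have cI : compact (nonlocal_integrand @` (supp `|` swap @` supp)).
  apply: continuous_compact => //; apply: continuous_in_subspaceT => p.
  by rewrite inE => /SO; exact: nonlocal_integrand_continuous.
have [M [_ HM]] := compact_bounded cI.
exists (`|M| + 1) => [|p Op]; first by rewrite addr_ge0.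
have [Sp|nSp] := pselect ((supp `|` swap @` supp) p).
  apply: (HM (`|M| + 1)); last by exists p.
  by rewrite (le_lt_trans (ler_norm M))// ltrDl.
rewrite nonlocal_integrand_support ?normr0 ?addr_ge0// => Sp; apply: nSp; first by left.
by right; exists (swap p) => //; case: (p).
Qed.

End nonlocal_divergence.

Section div_weight.
Context {R : realType} {N : nat} (Omega : set 'rV[R]_N).
Local Notation V := 'rV[R]_N.
Local Notation lam := (lebesgue_rV R N).
Hypothesis oOmega : open Omega.
Context (w : V * V -> R) (phi : V * V -> V).
Hypothesis w_C1 : C1_on (Omega `*` Omega) w.
Hypothesis phi_C1c : C1c_field Omega phi.

Let mOmega : measurable Omega. Proof. exact: open_measurable_rV. Qed.

Let open_OO : open (Omega `*` Omega).
Proof. exact: open_setX. Qed.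

Let measurable_integrand : measurable_fun (Omega `*` Omega) (nonlocal_integrand w phi).
Proof.
apply: continuous_on_open_measurable_fun => // p Op.
exact: nonlocal_integrand_continuous Op.
Qed.

(** Fubini-Tonelli, applied to the positive and negative parts of the integrand
    extended by zero. *)
Lemma div_weight_measurable : measurable_fun Omega (div_weight Omega w phi).
Proof.
pose g : V * V -> \bar R := (EFin \o nonlocal_integrand w phi) \_ (Omega `*` Omega).
have mg : measurable_fun setT g.
  apply/(measurable_restrictT _ _).1; first exact: measurableX.
  exact/measurable_EFinP.
pose F (h : V * V -> \bar R) x := (\int[lam]_y h (x, y))%E.
have mF h : measurable_fun setT h -> (forall p, (0 <= h p)%E) -> measurable_fun setT (F h).
  by move=> mh h0; exact: measurable_fun_fubini_tonelli_F.
have mFg : measurable_fun setT (fun x => fine (F g^\+ x - F g^\- x)%E).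
  apply: measurableT_comp => //; apply: emeasurable_funB; apply: mF.
  - exact: measurable_funepos.
  - by move=> p; exact: funepos_ge0.
  - exact: measurable_funeneg.
  - by move=> p; exact: funeneg_ge0.
apply: (eq_measurable_fun (fun x => fine (F g^\+ x - F g^\- x)%E)); last exact: measurable_funTS.
move=> x; rewrite inE => Ox; rewrite /div_weight /Rintegral; congr fine.
rewrite [RHS]integral_mkcond; set h := (X in _ = (\int[lam]_y X y)%E).
have -> : h = fun y => g (x, y).
  by apply/funext => y; rewrite /h /g !patchE in_setX (mem_set Ox).
by rewrite [RHS]integralE; congr (_ - _)%E; apply: eq_integral => y _;
  rewrite ?funeposE ?funenegE.
Qed.

Lemma div_weight_bounded : (lam Omega < +oo)%E ->
  exists2 M : R, 0 <= M & forall x, Omega x -> `|div_weight Omega w phi x| <= M.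
Proof.
move=> Ofin; have [M M0 HM] := nonlocal_integrand_bounded oOmega w_C1 phi_C1c.
exists (M * fine (lam Omega)) => [|x Ox]; first by rewrite mulr_ge0// fine_ge0.
have icst : lam.-integrable Omega (EFin \o (fun=> M) : V -> \bar R).
  apply/integrableP; split; first exact/measurable_EFinP/measurable_cst.
  by under eq_integral do rewrite /=; rewrite integral_cst//= lte_mul_pinfty.
have ig : lam.-integrable Omega (EFin \o (fun y => nonlocal_integrand w phi (x, y))).
  apply: (le_integrable mOmega _ _ icst).
    apply/measurable_EFinP.
    apply: (@measurable_comp _ _ _ _ _ _ (Omega `*` Omega) _ _ (fun y => (x, y))) => //.
    + exact: measurableX.
    + by move=> _ [y Oy <-].
    + exact: measurable_funTS (measurable_pair1 x).
  by move=> y Oy; rewrite /= lee_fin (le_trans (HM _ _))// ler_norm.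
apply: (le_trans (le_normr_Rintegral mOmega ig)).
rewrite -Rintegral_cst//; apply: le_Rintegral => //; first exact: integrable_norm.
by move=> y Oy; exact: HM.
Qed.

End div_weight.

(** * Minimization of convex functionals on L^q *)

Section Lspace_minimization.
Context d (T : measurableType d) (R : realType) (mu : {measure set T -> \bar R}).
Context (q : R) (q1 : 1 < q).
Local Notation L := (LspaceType mu (exponent_ge1 q1)).
Local Notation energy := (Lq_energy mu q).
Implicit Types (u v : L) (F G : L -> \bar R).

Let q0 : 0 < q. Proof. exact: lt_trans q1. Qed.

Let half01 : 0 <= (2^-1 : R) <= 1.
Proof. by rewrite invr_ge0 ler0n invf_le1 ?ler1n. Qed.

Lemma Lnorm_lt_energy (f : T -> R) (e : R) : 0 < e -> f \in Lfun mu q%:E ->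
  energy f < e `^ q -> ('N[mu]_q%:E[EFin \o f] < e%:E)%E.
Proof.
move=> e0 fL; apply: contraTT; rewrite -!leNgt => eN.
rewrite -lee_fin -(Lnorm_energy q1 fL) -poweR_EFin.
apply: gt0_ler_poweR => //; first exact: ltW.
  by rewrite in_itv/= leey andbT lee_fin ltW.
by rewrite in_itv/= leey andbT Lnorm_ge0.
Qed.

Lemma energy_le_Lnorm (f : T -> R) (r : R) : 0 <= r -> f \in Lfun mu q%:E ->
  ('N[mu]_q%:E[EFin \o f] <= r%:E)%E -> energy f <= r `^ q.
Proof.
move=> r0 fL Nr; rewrite -lee_fin -(Lnorm_energy q1 fL) -poweR_EFin.
apply: gt0_ler_poweR => //; first exact: ltW.
  by rewrite in_itv/= leey andbT Lnorm_ge0.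
by rewrite in_itv/= leey andbT lee_fin.
Qed.

(** The sublevel sets [C n] at heights decreasing to the infimum are nonempty, convex,
    closed by lower semicontinuity and bounded by coercivity; an element common to all
    of them is a minimizer. *)
Lemma exists_minimizer (muT : (mu setT < +oo)%E) F :
  bounded_below F -> convex_functional F -> lsc_functional F ->
  coercive_functional F -> exists u, forall v, (F u <= F v)%E.
Proof.
move=> [c Fc] Fconv Flsc Fcoer; pose m := ereal_inf (range F).
have mF v : (m <= F v)%E by apply: ereal_inf_lbound; exists v.
have [moo|moo] := eqVneq m +oo%E.
  have [u _] : exists u : L, (u : T -> R) = cst 0 %[ae mu].
    by apply: Lspace_repr; exact: (@Lfun_submod_closed _ _ _ mu _ (exponent_ge1 q1)).1.
  by exists u => v; have := mF v; rewrite moo leye_eq => /eqP ->; rewrite leey.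
have mfin : m \is a fin_num.
  rewrite fin_numE moo andbT gt_eqF// (@lt_le_trans _ _ c%:E) ?ltNyr//.
  by apply: le_ereal_inf_tmp => _ [u _ <-].
pose a n := fine m + n.+1%:R^-1.
have am n : (m < (a n)%:E)%E.
  by rewrite /a EFinD fineK// lteDl// lte_fin invr_gt0.
pose C n := [set u | (F u <= (a n)%:E)%E].
have [r Hr] := Fcoer (a 0%N).
have [|||||u Cu] := @nested_closed_convex _ _ _ mu _ q1 muT C (Num.max r 0 `^ q).
- by move=> n; have [_ [u _ <-] /ltW Fu] := ereal_inf_lt (am n); exists u.
- move=> i j ij u /le_trans; apply; rewrite lee_fin lerD2l lef_pV2 ?posrE//.
  by rewrite ler_nat.
- move=> u Fu; apply: energy_le_Lnorm; rewrite ?le_max ?lexx ?orbT//.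
    exact: Lspace_Lfun.
  rewrite EFin_max le_max; apply/orP; left; rewrite leNgt; apply/negP => /Hr.
  by rewrite ltNge Fu.
- move=> n u v w Cu Cv uvw.
  apply: le_trans (Fconv _ _ _ _ half01 uvw) _.
  have -> : a n = 2^-1 * a n + (1 - 2^-1) * a n by rewrite -mulrDl subrKC mul1r.
  have /andP[half0 half1] := half01.
  by rewrite [leRHS]EFinD !EFinM leeD// lee_wpmul2l// lee_fin// subr_ge0.
- move=> n s u Cs su; rewrite /C /= leNgt; apply/negP => /Flsc[e e0 He].
  have e2 : 0 < e / 2 by rewrite divr_gt0.
  have [k Hk] := su ((e / 2) `^ q) (powR_gt0 _ e2).
  suff /He : (Lspace_dist (s k) u < e%:E)%E by rewrite ltNge (Cs k).
  apply: Lnorm_lt_energy => //; first by apply: Lq_sub => //; exact: Lspace_Lfun.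
  apply: le_lt_trans (Hk k (leqnn k)) _; apply: gt0_ltr_powR => //; rewrite ?nnegrE ?(ltW e0) ?(ltW e2)//.
  by rewrite ltr_pdivrMr// ltr_pMr// ltr1n.
exists u => v; apply: le_trans (mF v).
apply/lee_addgt0Pr => e e0.
have [n Hn] : exists n, n.+1%:R^-1 <= e.
  exists (Num.truncn e^-1); rewrite invf_ple ?posrE//.
  by rewrite ltW// truncnS_gt.
apply: (le_trans (Cu n)); rewrite /a EFinD fineK// leeD2l//.
Qed.

Lemma lt_adde_split (x y : \bar R) (a : R) : (-oo < x)%E -> (-oo < y)%E ->
  (a%:E < x + y)%E -> exists b c : R, [/\ a = b + c, (b%:E < x)%E & (c%:E < y)%E].
Proof.
have wlog_fin (z : \bar R) : (-oo < z)%E -> exists b : R, (b%:E < z)%E.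
  by case: z => [z|_|//]; [exists (z - 1); rewrite lte_fin; lra|exists 0; rewrite ltry].
move=> xNy yNy axy; case: x xNy axy => [x| |//] _.
  case: y yNy => [y| |//] _.
    rewrite -EFinD lte_fin => axy.
    by exists (x - (x + y - a) / 2), (y - (x + y - a) / 2); rewrite !lte_fin; split; lra.
  by move=> _; exists (x - 1), (a - (x - 1)); rewrite ltry lte_fin; split => //; lra.
move=> _; have [c cy] := wlog_fin _ yNy.
by exists (a - c), c; rewrite ltry subrK.
Qed.

Lemma lsc_functionalD F G : (forall u, -oo < F u)%E -> (forall u, -oo < G u)%E ->
  lsc_functional F -> lsc_functional G -> lsc_functional (fun u => F u + G u)%E.
Proof.
move=> FNy GNy Flsc Glsc u a /(lt_adde_split (FNy u) (GNy u))[b [c [-> bF cG]]].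
have [e1 e10 He1] := Flsc _ _ bF; have [e2 e20 He2] := Glsc _ _ cG.
exists (Num.min e1 e2) => [|v]; first by rewrite lt_min e10.
rewrite EFin_min lt_min => /andP[v1 v2]; rewrite EFinD lteD//; [exact: He1|exact: He2].
Qed.

Lemma convex_functionalD F G : (forall u, -oo < F u)%E -> (forall u, -oo < G u)%E ->
  convex_functional F -> convex_functional G -> convex_functional (fun u => F u + G u)%E.
Proof.
move=> FNy GNy Fconv Gconv t u v w t01 uvw; have /andP[t0 t1] := t01.
have dist (s : R) (x y : \bar R) : 0 <= s -> (-oo < x)%E -> (-oo < y)%E ->
    (s%:E * (x + y) = s%:E * x + s%:E * y)%E.
  rewrite le_eqVlt => /predU1P[<-|s0]; first by rewrite !mul0e adde0.
  move=> xNy yNy; rewrite muleDr//.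
  by case: x xNy => [x| |//] _; case: y yNy => [y| |//] _.
rewrite !dist ?subr_ge0// addeACA leeD//; [exact: Fconv|exact: Gconv].
Qed.

End Lspace_minimization.

(** * The nonlocal total variation as a functional on L^q *)

Section NLTV_functional.
Context {R : realType} {N : nat} (Omega : set 'rV[R]_N) (oOmega : open Omega).
Hypothesis Omega_fin : (lebesgue_rV R N Omega < +oo)%E.
Context (w : 'rV[R]_N * 'rV[R]_N -> R) (w_C1 : C1_on (Omega `*` Omega) w).
Context (q : R) (q1 : 1 < q).
Local Notation V := 'rV[R]_N.
Local Notation lam := (lebesgue_rV R N).
Local Notation mu := (lebesgue_on oOmega).
Local Notation L := (Lq oOmega q1).
Implicit Types (u v : L) (phi : V * V -> V).

Let mOmega : measurable Omega. Proof. exact: open_measurable_rV. Qed.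

Lemma lebesgue_on_finite : (mu setT < +oo)%E.
Proof. by rewrite /= /mrestr setTI. Qed.

(** The total variation is defined by integrals over [Omega] for the Lebesgue measure,
    the space L^q by the restricted measure; this identity links the two. *)
Lemma integral_lebesgue_on (f : V -> \bar R) :
  (\int[lam]_(x in Omega) f x = \int[mu]_(x in Omega) f x)%E.
Proof.
by apply: eq_measure_integral => A mA AO; rewrite /= /mrestr setIidl.
Qed.

Lemma Lq_measurable_on u : measurable_fun setT (u : V -> R).
Proof. exact: Lq_measurable (Lspace_Lfun u). Qed.

Lemma Lq_integrable_on u : mu.-integrable Omega (EFin \o u).
Proof.
apply: (integrableS measurableT) => //.
exact: (Lq_integrable1 q1 lebesgue_on_finite (Lspace_Lfun u)).
Qed.

Lemma Lq_integrable_lebesgue u : lam.-integrable Omega (EFin \o u).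
Proof.
have /integrableP[mu_ uoo] := Lq_integrable_on u.
by apply/integrableP; split => //; rewrite integral_lebesgue_on.
Qed.

Definition div_pairing phi (f : V -> R) : R :=
  \int[lam]_(x in Omega) (f x * div_weight Omega w phi x).

Lemma div_pairingE phi (f : V -> R) :
  div_pairing phi f = \int[mu]_(x in Omega) (f x * div_weight Omega w phi x).
Proof. by congr fine; exact: integral_lebesgue_on. Qed.

Lemma measurable_div_pairing phi u : C1c_field Omega phi ->
  measurable_fun Omega (fun x => u x * div_weight Omega w phi x).
Proof.
move=> phi_C1c; apply: measurable_funM; last exact: div_weight_measurable.
by apply: measurable_funTS; exact: Lq_measurable_on.
Qed.

Lemma integrable_div_pairing phi u : C1c_field Omega phi ->
  mu.-integrable Omega (EFin \o (fun x => u x * div_weight Omega w phi x)).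
Proof.
move=> phi_C1c.
have [M M0 HM] := div_weight_bounded oOmega w_C1 phi_C1c Omega_fin.
have iu := integrableZl mOmega M (Lq_integrable_on u).
apply: (le_integrable mOmega _ _ iu).
  by apply/measurable_EFinP; exact: (measurable_div_pairing u phi_C1c).
move=> x Ox; rewrite /= lee_fin !normrM mulrC ler_wpM2r//.
by rewrite (ger0_norm M0) HM.
Qed.

Lemma div_pairing_convex_comb phi (t : R) u v (u' : L) : C1c_field Omega phi ->
  is_convex_comb t u v u' ->
  div_pairing phi u' = t * div_pairing phi u + (1 - t) * div_pairing phi v.
Proof.
move=> phi_C1c uv; rewrite !div_pairingE.
have iu := integrable_div_pairing u phi_C1c.
have iv := integrable_div_pairing v phi_C1c.
have iZ a (k : V -> R) : mu.-integrable Omega (EFin \o k) ->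
    mu.-integrable Omega (EFin \o (fun x => a * k x)).
  by move=> ik; exact: (integrableZl mOmega a ik).
rewrite -RintegralZl// -[X in _ = _ + X]RintegralZl// -RintegralD//; [|exact: iZ..].
congr fine; apply: ae_eq_integral => //.
- by apply/measurable_EFinP; exact: (measurable_div_pairing u' phi_C1c).
- apply/measurable_EFinP; apply: measurable_funD; apply: measurable_funM => //.
  + exact: (measurable_div_pairing u phi_C1c).
  + exact: (measurable_div_pairing v phi_C1c).
- apply: filterS uv => x /(_ I) + _ => /= ->.
  by rewrite mulrDl !mulrA.
Qed.

(** The weighted divergence of an admissible field is bounded, so the pairing with it
    is continuous for the L^1 norm, hence for the L^q norm. *)
Lemma div_pairing_continuous phi u (e : R) : C1c_field Omega phi -> 0 < e ->
  exists2 d : R, 0 < d & forall v, (Lspace_dist v u < d%:E)%E ->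
    `|div_pairing phi v - div_pairing phi u| <= e.
Proof.
move=> phi_C1c e0.
have [M M0 HM] := div_weight_bounded oOmega w_C1 phi_C1c Omega_fin.
have eM : 0 < e / (M + 1) by rewrite divr_gt0// ltr_wpDl.
have [c c0 Hc] := Lq_L1_small q1 lebesgue_on_finite eM.
have q0 : 0 < q by exact: lt_trans q1.
exists (c `^ q^-1) => [|v vu]; first exact: powR_gt0.
have vuL := Lq_sub q1 (Lspace_Lfun v) (Lspace_Lfun u).
have small : \int[mu]_x `|v x - u x| <= e / (M + 1).
  apply: Hc => //; apply: le_trans (energy_le_Lnorm q1 (powR_ge0 c q^-1) vuL (ltW vu)) _.
  by rewrite -powRrM mulVf ?gt_eqF// powRr1// ltW.
have iv := integrable_div_pairing v phi_C1c.
have iu := integrable_div_pairing u phi_C1c.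
have ivu := Lq_integrable1 q1 lebesgue_on_finite vuL.
have ivuO : mu.-integrable Omega (EFin \o (fun x => `|v x - u x|)).
  by apply: (integrableS measurableT) => //; exact: integrable_norm ivu.
have iB : mu.-integrable Omega (EFin \o (fun x => v x * div_weight Omega w phi x
    - u x * div_weight Omega w phi x)) by exact: (integrableB mOmega iv iu).
rewrite !div_pairingE -RintegralB//.
apply: (le_trans (le_normr_Rintegral mOmega iB)).
apply: (@le_trans _ _ (\int[mu]_(x in Omega) (M * `|v x - u x|))).
  apply: le_Rintegral => //; first exact: integrable_norm.
    exact: (integrableZl mOmega M ivuO).
  by move=> x Ox; rewrite -mulrBl normrM mulrC ler_wpM2r// HM.
rewrite RintegralZl//.
apply: (@le_trans _ _ (M * (e / (M + 1)))).
  rewrite ler_wpM2l// (le_trans _ small)//.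
  have fin_T := integrable_fin_num measurableT (integrable_norm ivu).
  rewrite fine_le//; first exact: integrable_fin_num.
  apply: ge0_subset_integral => //.
  by have /integrableP[] := integrable_norm ivu.
rewrite mulrC -mulrA mulrC ler_piMl ?(ltW e0)// mulrC.
by rewrite ler_pdivrMr ?ltr_wpDl// mul1r lerDl.
Qed.

Lemma div_pairing_le_NLTV phi (f : V -> R) : C1c_field Omega phi ->
  (sup_norm Omega phi <= 1)%E -> ((div_pairing phi f)%:E <= NLTV Omega w f)%E.
Proof. by move=> phi_C1c phi1; apply: ereal_sup_ubound; exists phi. Qed.

(** The zero field is an admissible competitor. *)
Lemma NLTV_ge0 (f : V -> R) : (0 <= NLTV Omega w f)%E.
Proof.
pose z := cst 0 : V * V -> V.
have z_set0 : [set p | z p != 0] = set0.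
  by apply/seteqP; split => // p /=; rewrite eqxx.
have z_C1c : C1c_field Omega z.
  split.
  - split => [p _|v p _]; first exact: differentiable_cst.
    rewrite (_ : (fun p => 'd z p v) = cst 0); first exact: cvg_cst.
    by apply/funext => r; rewrite diff_cst.
  - by rewrite z_set0 closure0; exact: compact0.
  - by rewrite z_set0 closure0.
have z1 : (sup_norm Omega z <= 1)%E.
  apply: ub_ereal_sup => _ [p _ <-]; rewrite lee_fin /euclidean_norm big1 ?sqrtr0//.
  by move=> i _; rewrite mxE expr0n.
apply: le_trans (div_pairing_le_NLTV f z_C1c z1).
rewrite lee_fin /div_pairing /Rintegral integral0_eq// => x Ox.
have -> : div_weight Omega w z x = 0.
  rewrite /div_weight /Rintegral integral0_eq// => y Oy.
  rewrite /divergence big1// => i _.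
  rewrite (_ : (fun _ => _) = cst 0) ?derive_cst//.
  by apply/funext => r; rewrite subrr scaler0 mxE.
by rewrite mulr0.
Qed.

(** A supremum of linear functionals. *)
Lemma NLTV_convex : convex_functional (fun u : L => NLTV Omega w u).
Proof.
move=> t u v u' /andP[t0 t1] uvu'; apply: ub_ereal_sup => _ [phi [phi_C1c phi1] <-].
rewrite -/(div_pairing phi u') (div_pairing_convex_comb phi_C1c uvu').
by rewrite EFinD !EFinM leeD// lee_wpmul2l ?lee_fin ?subr_ge0//; exact: div_pairing_le_NLTV.
Qed.

(** A supremum of continuous functionals. *)
Lemma NLTV_lsc : lsc_functional (fun u : L => NLTV Omega w u).
Proof.
move=> u a /ereal_sup_gt[_ [phi [phi_C1c phi1] <-]].
rewrite -/(div_pairing phi u) lte_fin => au.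
have gap : 0 < (div_pairing phi u - a) / 2 by rewrite divr_gt0// subr_gt0.
have [d d0 Hd] := div_pairing_continuous u phi_C1c gap; exists d => // v /Hd.
rewrite ler_norml => /andP[h _].
by apply: lt_le_trans (div_pairing_le_NLTV v phi_C1c phi1); rewrite lte_fin; lra.
Qed.

End NLTV_functional.

(** * Existence and uniqueness of the minimizer *)

Lemma adde_lt_mean (R : realType) (a b c m : \bar R) (x y z : \bar R) :
  (0 <= a < +oo)%E -> (0 <= b < +oo)%E -> (-oo < x)%E -> (-oo < y)%E ->
  (a + x = m)%E -> (b + y = m)%E ->
  (c <= (2^-1)%:E * a + (1 - 2^-1)%:E * b)%E -> (0 <= c)%E ->
  (z < (2^-1)%:E * x + (1 - 2^-1)%:E * y)%E -> (-oo < z)%E -> (c + z < m)%E.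
Proof.
case: a => [a| |] //; last by rewrite ltxx andbF.
case: b => [b| |] //; last by rewrite ltxx andbF.
move=> _ _; case: x => [x| |] // _; case: y => [y| |] // _ => <- //=;
  rewrite -?EFinD -?EFinM -?EFinD;
  case: c => [c| |] //; case: z => [z| |] //.
- move=> [] xy + _ + _; rewrite -EFinD !lee_fin !lte_fin; lra.
- by move=> _ _ _ _ _; rewrite -EFinD ltry.
- by move=> _ _ _; rewrite ltNge leey.
Qed.

(** At the midpoint of two distinct minimizers the total variation is at most the mean
    of its values, and finite, while [F] is strictly below the mean: the sum would be
    strictly below the infimum. *)
Lemma minimizer_unique (R : realType) (N : nat) (Omega : set 'rV[R]_N)
    (oOmega : open Omega) (Omega_fin : (lebesgue_rV R N Omega < +oo)%E)
    (w : 'rV[R]_N * 'rV[R]_N -> R) (w_C1 : C1_on (Omega `*` Omega) w)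
    (q : R) (q1 : 1 < q) (F : Lq oOmega q1 -> \bar R) (FNy : forall u, (-oo < F u)%E)
    (D := [set u : Lq oOmega q1 | NLBV Omega w u])
    (I := fun u : Lq oOmega q1 => (NLTV Omega w u + F u)%E)
    (u v : Lq oOmega q1) :
  (forall u' : Lq oOmega q1, u <> v -> is_convex_comb 2^-1 u v u' ->
    (F u' < (2^-1)%:E * F u + (1 - 2^-1)%:E * F v)%E) ->
  minimizer D I u -> minimizer D I v -> u = v.
Proof.
move=> Fstrict [[_ uoo] Iu] [[_ voo] Iv]; apply: contrapT => uv.
have [u' Hu'] : exists u' : Lq oOmega q1, is_convex_comb 2^-1 u v u'.
  by have := Lspace_repr (exponent_ge1 q1)
    (Lq_lincomb q1 2^-1 (1 - 2^-1) (Lspace_Lfun u) (Lspace_Lfun v)).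
have half01 : 0 <= (2^-1 : R) <= 1 by rewrite invr_ge0 ler0n invf_le1 ?ler1n.
have NLTV_u' := NLTV_convex Omega_fin w_C1 half01 Hu'.
have Du' : D u'.
  split; first exact: Lq_integrable_lebesgue.
  apply: le_lt_trans NLTV_u' _; rewrite lte_add_pinfty// lte_mul_pinfty//.
  by case/andP: half01 => _; rewrite lee_fin subr_ge0.
have := adde_lt_mean _ _ (FNy u) (FNy v) Iu Iv NLTV_u' (NLTV_ge0 _ _ _) (Fstrict _ uv Hu') (FNy u').
rewrite !NLTV_ge0 => /(_ uoo voo); rewrite ltNge => /negP; apply.
by apply: ereal_inf_lbound; exists u'.
Qed.

Lemma NLBV_nonempty (R : realType) (N : nat) (Omega : set 'rV[R]_N)
    (oOmega : open Omega) (Omega_fin : (lebesgue_rV R N Omega < +oo)%E)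
    (w : 'rV[R]_N * 'rV[R]_N -> R) (w_C1 : C1_on (Omega `*` Omega) w)
    (q : R) (q1 : 1 < q) : exists u : Lq oOmega q1, NLBV Omega w u.
Proof.
have zeroL := (@Lfun_submod_closed _ _ _ (lebesgue_on oOmega) _ (exponent_ge1 q1)).1.
have [u u0] := Lspace_repr (exponent_ge1 q1) zeroL.
exists u; split; first exact: Lq_integrable_lebesgue.
apply: (@le_lt_trans _ _ 0%E); last exact: ltry.
apply: ub_ereal_sup => _ [phi [phi_C1c _] <-].
rewrite lee_fin -/(div_pairing Omega w phi u) (div_pairingE oOmega).
rewrite /Rintegral (ae_eq_integral (cst 0%E)) ?integral0//.
- exact: open_measurable_rV.
- by apply/measurable_EFinP; exact: measurable_div_pairing.
- by apply: filterS u0 => x /(_ I) /= -> _; rewrite mul0r.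
Qed.

Theorem theorem1p7 (R : realType) (N : nat) (N_gt0 : (0 < N)%N)
    (Omega : set 'rV[R]_N) (oOmega : open Omega) (Omega_neq0 : Omega !=set0)
    (Omega_fin : (lebesgue_rV R N Omega < +oo)%E)
    (w : 'rV[R]_N * 'rV[R]_N -> R) (hw : admissible_weight Omega w)
    (q : R) (q1 : 1 < q)
    (F : Lq oOmega q1 -> \bar R)
    (F_proper : proper_functional F)
    (F_bounded_below : bounded_below F)
    (F_convex : convex_functional F)
    (F_lsc : lsc_functional F)
    (F_coercive : coercive_functional F) :
  let D := [set u : Lq oOmega q1 | NLBV Omega w u] in
  let I := fun u : Lq oOmega q1 => (NLTV Omega w u + F u)%E in
  (exists u, minimizer D I u) /\
  (strictly_convex_functional F ->
   forall u v, minimizer D I u -> minimizer D I v -> u = v) /\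
  (strictly_convex_on_domain F -> (ereal_inf [set I u | u in D] < +oo)%E ->
   forall u v, minimizer D I u -> minimizer D I v -> u = v).
Proof.
move=> D I; have w_C1 := weight_C1 hw; have [FNy _] := F_proper.
have half01 : 0 < (2^-1 : R) < 1 by rewrite invr_gt0 ltr0n invf_lt1 ?ltr1n.
have NLTV_Ny u : (-oo < NLTV Omega w u)%E by apply: lt_le_trans (NLTV_ge0 _ _ _).
split; last split.
- have [c Fc] := F_bounded_below.
  have [||||u minu] := @exists_minimizer _ _ _ _ _ q1 (lebesgue_on_finite oOmega Omega_fin) I.
  + by exists c => u; apply: (le_trans (Fc u)); rewrite leeDr// NLTV_ge0.
  + by apply: convex_functionalD => //; exact: NLTV_convex.
  + by apply: lsc_functionalD => //; exact: NLTV_lsc.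
  + move=> M; have [r Hr] := F_coercive M; exists r => u /Hr Mu.
    by apply: (lt_le_trans Mu); rewrite leeDr// NLTV_ge0.
  have [Iuoo|] := ltP (I u) +oo%E.
    have Du : D u.
      split; first exact: Lq_integrable_lebesgue.
      by rewrite ltey; apply: contraTneq Iuoo => NLTVoo; rewrite /I NLTVoo addye// gt_eqF.
    exists u; split => //; apply/eqP; rewrite eq_le; apply/andP; split.
      by apply: le_ereal_inf_tmp => _ [v _ <-].
    by apply: ereal_inf_lbound; exists u.
  (* If the sum is infinite everywhere, every element of [D] is a minimizer. *)
  rewrite leye_eq => /eqP Iuoo.
  have Ioo v : I v = +oo%E by apply/eqP; rewrite -leye_eq -Iuoo.
  have [v Dv] : D !=set0 by exact: NLBV_nonempty.
  exists v; split => //; rewrite Ioo; apply/esym/eqP; rewrite -leye_eq.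
  by apply: le_ereal_inf_tmp => _ [v' _ <-]; rewrite Ioo.
- move=> Fstrict u v; apply: minimizer_unique => // u' uv; exact: Fstrict.
- move=> Fstrict infoo u v umin vmin; apply: (minimizer_unique _ _ _ _ umin vmin) => // u' uv.
  have Ffin v' : minimizer D I v' -> (F v' < +oo)%E.
    move=> [_ Iv']; rewrite -Iv' in infoo; apply: (le_lt_trans _ infoo).
    by rewrite leeDr// NLTV_ge0.
  by apply: Fstrict => //; exact: Ffin.
Qed.
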